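(* Fix $p\in\{0,1,2,\dots\}$ and $\kappa\in(0,1)$. Let $Y_t=\beta_0+\beta_1t+\dots+\beta_pt^p+\epsilon_t$, $t\in\mathbb N$, with unknown $(\beta_0,\dots,\beta_p)'\in\mathbb R^{p+1}$ and $E(\epsilon_t)=0$ for all $t$. Suppose the null hypothesis holds that the errors form a random walk, i.e. $\epsilon_t=\epsilon_{t-1}+u_t$ for all $t\in\mathbb N$, where $\{u_t:t\in\mathbb N\}$ satisfies assumption (E) of the context with constant $\eta\in(0,\infty)$. Then the sequentially updated residual process $\widehat E_{\lfloor Tr\rfloor}(\lfloor Ts\rfloor)$ defined in the context satisfies $$\widehat E_{\lfloor Tr\rfloor}(\lfloor Ts\rfloor)\ \stackrel{w}{\to}\ \mathcal E(r,s)\qquad\text{in } D([\kappa,1]^2;\mathbb R),\quad T\to\infty,$$ where the process $\mathcal E$ is given by $$\mathcal E(r,s)=\eta\Big\{B(r)-\mathbf v(r,s)'\,s^{-1}\,\mathbf H^{-1}\int_0^s\mathbf v(u,s)\,B(u)\,du\Big\},\qquad \mathbf v(r,s)=(1,r/s,\dots,(r/s)^p)',$$ for $\kappa\le r\le s\le 1$, and $B$ is standard Brownian motion with $B(0)=0$.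
   Context: Assumption (E): $\{u_t:t\in\mathbb N\}$ is strictly stationary with mean zero, $E|u_1|^2<\infty$, $\sum_{t=1}^\infty|\mathrm{Cov}(u_1,u_{1+t})|<\infty$, and $T^{-1/2}\sum_{i\le\lfloor Ts\rfloor}u_i\stackrel{w}{\to}\eta B(s)$ in the Skorohod space $D[0,1]$ as $T\to\infty$, for some constant $0<\eta<\infty$, where $B$ is Brownian motion with $B(0)=0$. Notation: $\mathbf x_t=(1,t,\dots,t^p)'$; $\mathbf X_n=[\mathbf x_1,\dots,\mathbf x_n]'$ is the $n\times(p+1)$ polynomial design matrix; $\mathbf Y_t=(Y_1,\dots,Y_t)'$. $\mathbf H=(1/(i+j-1))_{i,j=1,\dots,p+1}$ is the Hilbert matrix of dimension $p+1$. For $p+1\le k\le t\le T$, $\widehat\epsilon_k(t)=Y_k-\mathbf x_k'(\mathbf X_t'\mathbf X_t)^{-1}\mathbf X_t'\mathbf Y_t$ is the $k$-th least squares residual, associated to $Y_k$ and calculated from $Y_1,\dots,Y_t$. The sequentially updated residual process is $$\widehat E_{\lfloor Tr\rfloor}(\lfloor Ts\rfloor)=T^{-1/2}\,\widehat\epsilon_{\lfloor Tr\rfloor}(\lfloor Ts\rfloor),\qquad r\in[\kappa,s],\ s\in[\kappa,1],$$ and the definition is extended by putting $\widehat E_{\lfloor Tr\rfloor}(\lfloor Ts\rfloor)=0$ if $r>s$ or $r,s\in[0,\kappa)$. $D([0,1]^2;\mathbb R)$ is the uniform closure, in the space of bounded functions on $[0,1]^2$, of the linear span of indicators $\mathbf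 1_{E_1\times E_2}$, where each $E_i$ is a left-closed right-open subinterval of $[0,1]$ or the singleton $\{1\}$. Its metric $d_2(f,g)$ is the smallest $\varepsilon>0$ such that there are continuous bijections $\lambda_1,\lambda_2$ of $[0,1]$ with $\|\lambda-\mathrm{id}\|_\infty\le\varepsilon$ and $\|f-g\circ\lambda\|_\infty\le\varepsilon$, where $\lambda=(\lambda_1,\lambda_2)$ and $g\circ\lambda(r,s)=g(\lambda_1(r),\lambda_2(s))$. $D([\kappa,1]^2;\mathbb R)$ is defined in the same way with $[\kappa,1]$ in place of $[0,1]$. $X_n\stackrel{w}{\to}X$ denotes weak convergence: $E h(X_n)\to E h(X)$ for all bounded measurable real functions $h$ that are continuous with respect to the metric.
   Formalization: The processes, set to 0 for r>s but nonzero on the diagonal, do not lie in D([κ,1]²;R) as defined; convergence is stated in the larger space of functions equal to one element of D([κ,1]²;R) on r≤s and another on r>s, with the same metric d_2. *)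

(* Defs.v *)
From HB Require Import structures.
From mathcomp Require Import all_boot all_order all_algebra.
From mathcomp Require Import all_classical all_reals all_analysis.
Import Order.TTheory GRing.Theory Num.Theory.
Import numFieldNormedType.Exports.

Set Implicit Arguments.
Unset Strict Implicit.
Unset Printing Implicit Defensive.

Local Open Scope classical_set_scope.
Local Open Scope ring_scope.

(* Elements of the function spaces below are represented by total functions
   (on R or R * R); every notion attached to [a, b] or [a, b]^2 ignores the
   values taken outside, so that the distances are only pseudometrics on total
   functions and a continuous functional cannot see those values. *)

Section weak_convergence.
Context {R : realType} {I : Type}.
Variables (J : set I) (D : set (I -> R)) (dist : (I -> R) -> (I -> R) -> R).

Definition coordinate_sigma_algebra : set (set (I -> R)) :=
  <<s D, [set C | exists i (A : set R),
            [/\ J i, measurable A & C = D `&` [set f | A (f i)]] ] >>.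

Definition random_element d (Omega : measurableType d) (X : Omega -> I -> R) :=
  (forall w, D (X w)) /\
  (forall C, coordinate_sigma_algebra C -> measurable (X @^-1` C)).

Definition dist_continuous (h : (I -> R) -> R) :=
  forall f, D f -> forall e : R, 0 < e -> exists2 delta : R, 0 < delta &
    forall g, D g -> dist f g < delta -> `|h f - h g| < e.

Definition test_functional (h : (I -> R) -> R) :=
  [/\ exists M : R, forall f, D f -> `|h f| <= M,
      forall A : set R, measurable A ->
        coordinate_sigma_algebra (D `&` h @^-1` A)
    & dist_continuous h].

Definition weak_cvg d (Omega : measurableType d) (P : probability Omega R)
    d' (Omega' : measurableType d') (P' : probability Omega' R)
    (X : nat -> Omega -> I -> R) (Xlim : Omega' -> I -> R) :=
  [/\ forall n, random_element (X n),
      random_element Xlim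
    & forall h, test_functional h ->
        ('E_P[h \o X n])%E @[n --> \oo] --> ('E_P'[h \o Xlim])%E].

End weak_convergence.

Section skorohod_spaces.
Context {R : realType}.
Implicit Types (a b : R).

Definition time_change a b (l : R -> R) :=
  set_bij `[a, b]%classic `[a, b]%classic l /\
  {within `[a, b]%classic, continuous l}.

Definition D1 a b : set (R -> R) :=
  [set f : R -> R | (forall x, a <= x < b -> f y @[y --> x^'+] --> f x) /\
           (forall x, a < x <= b -> cvg (f y @[y --> x^'-]))].

Definition d1 a b (f g : R -> R) : R :=
  inf [set e | 0 < e /\ exists l, [/\ time_change a b l,
    forall x, a <= x <= b -> `|l x - x| <= e
  & forall x, a <= x <= b -> `|f x - g (l x)| <= e] ].

Definition square a b : set (R * R) := `[a, b] `*` `[a, b].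

Definition cell a b (E : set R) :=
  (exists c d, [/\ a <= c, d <= b & E = `[c, d[%classic]) \/ E = [set b].

Definition rectangle_span a b : set (R * R -> R) :=
  [set g | exists n (c : 'I_n -> R) (E1 E2 : 'I_n -> set R),
     (forall i, cell a b (E1 i) /\ cell a b (E2 i)) /\
     g = (fun x => \sum_(i < n) c i * \1_(E1 i `*` E2 i) x)].

Definition D2 a b : set (R * R -> R) :=
  [set f | forall e : R, 0 < e -> exists2 g, rectangle_span a b g &
     forall x, square a b x -> `|f x - g x| <= e].

Definition d2 a b (f g : R * R -> R) : R :=
  inf [set e | 0 < e /\ exists l1 l2,
   [/\ time_change a b l1, time_change a b l2,
       forall x, a <= x <= b -> `|l1 x - x| <= e /\ `|l2 x - x| <= e
     & forall x, square a b x -> `|f x - g (l1 x.1, l2 x.2)| <= e] ].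

(* Functions given by one element of D([a,b]^2) on {r <= s} and by another one
   on {r > s}.  This contains [D2 a b], on which it induces the same metric and
   coordinate projections.  The enlargement is needed because a function that
   vanishes for r > s without vanishing on the diagonal is not in [D2 a b]:
   the indicator of {r <= s} is not a uniform limit of rectangle steps. *)
Definition D2_diag a b : set (R * R -> R) :=
  [set f | exists g k, [/\ D2 a b g, D2 a b k &
     forall x, square a b x -> f x = if x.1 <= x.2 then g x else k x] ].

End skorohod_spaces.

Section processes.
Context {R : realType} {d : measure_display} {Omega : measurableType d}.
Variable P : probability Omega R.

Definition mutually_independent n (Z : 'I_n -> Omega -> R) :=
  forall A : 'I_n -> set R, (forall i, measurable (A i)) ->
    P [set w | forall i, A i (Z i w)] = (\prod_(i < n) P (Z i @^-1` A i))%E.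

(* standard Brownian motion on [0, 1]; normal_prob takes the standard
   deviation as its second parameter *)
Definition brownian_motion (B : R -> {RV P >-> R}) :=
  [/\ forall w, B 0 w = 0,
      forall n (t : nat -> R),
        (forall i, (i <= n)%N -> 0 <= t i <= 1) ->
        (forall i, (i < n)%N -> t i <= t i.+1) ->
        mutually_independent (fun (i : 'I_n) w => B (t i.+1) w - B (t i) w),
      forall s t : R, 0 <= s -> s < t -> t <= 1 ->
        forall A : set R, measurable A ->
          P [set w | A (B t w - B s w)] = normal_prob 0 (Num.sqrt (t - s)) A
    & forall w, {within `[0, 1]%classic, continuous (fun t => B t w)}].

(* time starts at 1: u 0 plays no role *)
Definition strictly_stationary (u : nat -> {RV P >-> R}) :=
  forall m (t : 'I_m -> nat) (h : nat), (forall i, (0 < t i)%N) ->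
  forall A : set (m.-tuple R), measurable A ->
    P [set w | A [tuple u (t i) w | i < m] ] =
    P [set w | A [tuple u (t i + h)%N w | i < m] ].

Definition partial_sum_process (u : nat -> {RV P >-> R}) (T : nat)
    (w : Omega) (s : R) : R :=
  (Num.sqrt T%:R)^-1 * \sum_(1 <= i < (Num.truncn (T%:R * s)).+1) u i w.

Definition assumption_E (u : nat -> {RV P >-> R}) (eta : R)
    d' (Omega' : measurableType d') (P' : probability Omega' R)
    (B : R -> {RV P' >-> R}) :=
  [/\ strictly_stationary u /\
        (forall t, (0 < t)%N -> ('E_P[u t] = 0)%E),
      ('E_P[fun w => (`|u 1%N w| ^+ 2)%R] < +oo)%E,
      (\sum_(1 <= t <oo) `|covariance P (u 1%N) (u t.+1)| < +oo)%E
    & weak_cvg `[0, 1]%classic (D1 0 1) (d1 0 1) P P'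
        (partial_sum_process u) (fun w s => eta * B s w)].

End processes.

Section residuals.
Context {R : realType}.
Variable p : nat.

Definition regressor (t : nat) : 'cV[R]_p.+1 := \col_(j < p.+1) t%:R ^+ j.

Definition design (n : nat) : 'M[R]_(n, p.+1) :=
  \matrix_(i < n, j < p.+1) regressor i.+1 j 0.

(* for t < p + 1 the Gram matrix is singular and invmx is a dummy value *)
Definition residual (Y : nat -> R) (k t : nat) : R :=
  Y k - ((regressor k)^T *m invmx ((design t)^T *m design t) *m (design t)^T
           *m \col_(i < t) Y i.+1) 0 0.

Definition residual_process (kappa : R) (Y : nat -> R) (T : nat)
    (x : R * R) : R :=
  let: (r, s) := x in
  if kappa <= r <= s
  then (Num.sqrt T%:R)^-1 *
         residual Y (Num.truncn (T%:R * r)) (Num.truncn (T%:R * s))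
  else 0.

(* indices start at 0, whence i + j + 1 instead of i + j - 1 *)
Definition hilbert_matrix : 'M[R]_p.+1 :=
  \matrix_(i, j) ((i + j).+1%:R)^-1.

Definition vvec (r s : R) : 'cV[R]_p.+1 := \col_(j < p.+1) (r / s) ^+ j.

Definition limit_process (kappa eta : R) (b : R -> R) (x : R * R) : R :=
  let: (r, s) := x in
  if kappa <= r <= s
  then eta * (b r - ((vvec r s)^T *m (s^-1 *: invmx hilbert_matrix) *m
         \col_(j < p.+1)
           \int[lebesgue_measure]_(u in `[0, s]) (vvec u s j 0 * b u)) 0 0)
  else 0.

End residuals.

(* Main.v *)
Require Import Defs.
From mathcomp Require Import all_boot all_order all_algebra.
From mathcomp Require Import all_classical all_reals all_analysis.
From mathcomp Require Import measurable_realfun.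
From mathcomp Require Import ring lra.
Import Order.TTheory GRing.Theory Num.Theory.
Import numFieldNormedType.Exports.
Local Open Scope classical_set_scope.
Local Open Scope ring_scope.

(** The residuals are least squares projections, so a polynomial trend and the
    initial value [eps 0] drop out, and what is left is a linear functional of
    the rescaled partial sums [S_T].  After rescaling time by [1/t] the Gram
    matrix [t^-1 X'X] has the Riemann sums of [u ^ (i + j)] as entries; it
    tends to the Hilbert matrix, which is invertible
    ([hilbert_matrix_unit], [cvg_scaled_gram]).  Hence for large [T] the
    residual process [X_T] is [sampled_residual p T S_T], a bounded operator
    applied to [S_T] ([residual_process_sampled], [sampled_residual_le]), and
    for every fixed continuous path [g] the images [sampled_residual p T g]
    tend uniformly on [kappa <= r <= s <= 1] to [Phi g], where
    [Phi = projection_residual p] maps [eta * B] to the limit process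
    ([sampled_residual_cvg], [limit_processE]).  It follows that

      [|X_T - Phi g| <= C * |S_T - g| + o(1)]   for every continuous [g],

    in uniform distances ([sampled_residual_approx]).

    The operators are not Skorohod continuous on the whole of D[0,1], and a
    continuous mapping argument through open sets of paths would meet the
    question whether these sets belong to the coordinate sigma-algebra.
    [weak_cvg_transfer] argues with functionals instead.  For a test functional
    [h] and a continuous [g], let [m] be the infimum of [h x + L |x - Phi g|]
    over [x]; then [h x >= m - L |x - Phi g|] for all [x], and the
    estimate above turns this into

      [h X_T >= m - L C |S_T - g| - o(1)].

    The right-hand side, a cone with apex at [g], is continuous for the
    Skorohod distance because [g] is continuous ([dist_continuous_supdist]),
    and measurable because the supremum can be taken over rational times
    ([supdist_rat]).  So is the maximum of finitely many cones, cut at a lower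
    bound of [h], and weak convergence of [S_T] applies to it.  With [L]
    ranging over the integers and [g] over a countable dense set of continuous
    functions ([countable_dense_continuous]), these maxima increase to
    [h (Phi W)] along the continuous paths of the limit [W], because [h] is
    continuous.  This gives [liminf E h(X_T) >= E h(Phi W)]; the same for [- h]
    gives the convergence. *)

Set Implicit Arguments.
Unset Strict Implicit.
Unset Printing Implicit Defensive.

(** * Cadlag paths and their distance to a continuous function *)

Section paths.
Context {R : realType}.
Implicit Types (a b : R) (f g : R -> R).

(** One-sided limits bound [f] near every point of [[a, b]], and compactness
    turns the local bounds into a global one. *)
Lemma D1_bounded a b f : D1 a b f ->
  exists M : R, forall x, a <= x <= b -> `|f x| <= M.
Proof.
move=> [fr fl].
have loc (x : R) : a <= x -> x <= b ->
    exists M0 : R, \forall x' \near x, x' \in `[a, b] -> `|f x'| <= M0.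
  move=> ax xb.
  have [l Hl] : exists l, \forall y \near x, y < x -> y \in `[a, b] -> `|f y| <= l.
    move: ax; rewrite le_eqVlt => /predU1P[<-|ax].
      exists 0; near=> y => ya; rewrite in_itv/= => /andP[ay _].
      by move: (lt_le_trans ya ay); rewrite ltxx.
    have /fl : a < x <= b by rewrite ax xb.
    move=> /cvg_ex[l fl'].
    exists (`|l| + 1).
    have := @cvgr_norm_le R R^o _ _ _ f l fl' _ (ltr_pwDr ltr01 (lexx `|l|)).
    rewrite near_withinE => H.
    by near=> y => yx _; move: yx; near: y; exact: H.
  have [r Hr] : exists r, \forall y \near x, x < y -> y \in `[a, b] -> `|f y| <= r.
    move: xb; rewrite le_eqVlt => /predU1P[->|xb].
      exists 0; near=> y => ya; rewrite in_itv/= => /andP[_ ay].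
      by move: (lt_le_trans ya ay); rewrite ltxx.
    have /fr fr' : a <= x < b by rewrite ax xb.
    exists (`|f x| + 1).
    have := @cvgr_norm_le R R^o _ _ _ f (f x) fr' _ (ltr_pwDr ltr01 (lexx `|f x|)).
    rewrite near_withinE => H.
    by near=> y => yx _; move: yx; near: y; exact: H.
  exists (Num.max `|f x| (Num.max l r)).
  near=> y => yab; rewrite !le_max.
  have [yx|xy|->] := ltgtP y x; last by rewrite lexx.
    have -> : `|f y| <= l by move: yx yab; near: y.
    by rewrite orbT.
  have -> : `|f y| <= r by move: xy yab; near: y.
  by rewrite !orbT.
have /compact_near_coveringP/near_covering_withinP cov := @segment_compact R a b.
have := cov R +oo%R (fun M x => `|f x| <= M) _.
case.
  move=> x /=; rewrite in_itv/= => /andP[ax xb].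
  have [M0 HM] := loc x ax xb.
  near=> x' M => /= xab.
  apply: (@le_trans _ _ M0); first by move: (xab); near: x'.
  by near: M; apply: nbhs_pinfty_ge; rewrite num_real.
move=> N [_ HN].
exists (N + 1) => x xab.
by apply: (HN (N + 1)); rewrite ?ltrDl//= in_itv/=.
Unshelve. all: by end_near. Qed.

Lemma time_change_id a b : time_change a b id.
Proof.
split; last by apply: continuous_subspaceT => y; exact: cvg_id.
by split => // x xab; exists x.
Qed.

(** The infimum of an empty set of errors would be 0, and a small distance would
    then say nothing.  Boundedness of both paths makes the identity an admissible
    time change, whence the infimum is approached by actual time changes. *)
Lemma d1_lt a b f g e : D1 a b f -> D1 a b g -> d1 a b f g < e ->
  exists2 c : R, c < e & exists l, [/\ time_change a b l,
    forall x, a <= x <= b -> `|l x - x| <= c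
  & forall x, a <= x <= b -> `|f x - g (l x)| <= c].
Proof.
move=> /D1_bounded[M HM] /D1_bounded[N HN] /inf_lt[|c [c0 [l Hl]] ce]; last first.
  by exists c => //; exists l.
exists (1 + `|M| + `|N|); split; first by rewrite -addrA ltr_pwDl// addr_ge0.
exists id; split.
- exact: time_change_id.
- by move=> x _; rewrite subrr normr0 !addr_ge0.
- move=> x xab; apply: le_trans (ler_normB _ _) _.
  rewrite -addrA ler_wpDl// lerD//.
    by apply: le_trans (HM _ xab) (ler_norm _).
  by apply: le_trans (HN _ xab) (ler_norm _).
Qed.

Lemma within_continuous_unif a b g : {within `[a, b], continuous g} ->
  forall e, 0 < e -> exists2 d : R, 0 < d & forall x y, a <= x <= b -> a <= y <= b ->
    `|x - y| < d -> `|g x - g y| < e.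
Proof.
move=> /subspace_continuousP cg e e0.
have /compact_near_coveringP/near_covering_withinP cov := @segment_compact R a b.
have loc (x : R) : x \in `[a, b] -> exists2 r, 0 < r &
    forall y, a <= y <= b -> `|x - y| < r -> `|g x - g y| < e / 2.
  move=> xab; have e20 : 0 < e / 2 by rewrite divr_gt0.
  have := @cvgr_dist_lt R R^o _ _ _ g (g x) (cg x xab) _ e20.
  by rewrite near_withinE => -[r r0 Hr]; exists r => // y yab xy; exact: Hr.
have := cov R 0^'+ (fun d x => forall y, a <= y <= b ->
  `|x - y| < d -> `|g x - g y| < e) _.
case.
  move=> x xab; have [r r0 Hr] := loc x xab.
  near=> x' d => x'ab y yab xyd.
  have xx' : `|x - x'| < r / 2.
    by near: x'; exists (r / 2) => //=; rewrite divr_gt0.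
  have dr : d <= r / 2 by near: d; apply: nbhs_right_le; rewrite divr_gt0.
  have h1 : `|g x - g x'| < e / 2.
    apply: Hr; first by move: x'ab; rewrite /= in_itv.
    by apply: lt_le_trans xx' _; rewrite ler_pdivrMr// ler_peMr ?ltW// ltr1n.
  have h2 : `|g x - g y| < e / 2.
    apply: Hr => //.
    rewrite (_ : x - y = (x - x') + (x' - y)); last by rewrite addrA subrK.
    rewrite (le_lt_trans (ler_normD _ _))// (splitr r) ltrD//.
    exact: lt_le_trans xyd dr.
  rewrite (_ : g x' - g y = (g x - g y) - (g x - g x')); last by ring.
  by rewrite (le_lt_trans (ler_normB _ _))// (splitr e) ltrD.
move=> d /= d0 Hd; exists (d / 2); first by rewrite divr_gt0.
move=> x y xab yab xyd; apply: (Hd (d / 2)) => //=.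
- by rewrite sub0r normrN gtr0_norm ?divr_gt0// ltr_pdivrMr// ltr_pMr// ltr1n.
- by rewrite divr_gt0.
Unshelve. all: by end_near. Qed.

Lemma within_continuous_bounded a b g : {within `[a, b], continuous g} ->
  exists M : R, forall x, a <= x <= b -> `|g x| <= M.
Proof.
move=> cg; have /compact_bounded[M [_ HM]] :=
  continuous_compact cg (@segment_compact R a b).
exists (M + 1) => x xab; apply: HM; first by rewrite ltrDl.
by exists x => //; rewrite /= in_itv.
Qed.

Definition supdist a b g f := sup [set `|f t - g t| | t in `[a, b]].

Lemma supdist_ge a b g f t : {within `[a, b], continuous g} -> D1 a b f ->
  a <= t <= b -> `|f t - g t| <= supdist a b g f.
Proof.
move=> /within_continuous_bounded[M HM] /D1_bounded[N HN] tab.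
apply: ub_le_sup; last by exists t => //=; rewrite in_itv.
exists (N + M) => ? [u /=]; rewrite in_itv/= => uab <-.
by rewrite (le_trans (ler_normB _ _))// lerD// (HM, HN).
Qed.

Lemma supdist_le a b g f c : a <= b ->
  (forall t, a <= t <= b -> `|f t - g t| <= c) -> supdist a b g f <= c.
Proof.
move=> ab H; apply: sup_le_ub.
  by exists `|f a - g a|, a => //=; rewrite in_itv/= lexx.
by move=> ? [u /=]; rewrite in_itv/= => uab <-; exact: H.
Qed.

Lemma supdist_ge0 a b g f : a <= b -> {within `[a, b], continuous g} ->
  D1 a b f -> 0 <= supdist a b g f.
Proof.
by move=> ab cg Df; apply: le_trans (supdist_ge (t := a) cg Df _); rewrite ?lexx.
Qed.

(** If [f] is close to [f' \o l], then [|f - g|] at [t] differs from [|f' - g|] at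
    [l t] by that error and by the oscillation of [g] between [t] and [l t], which
    is small because [g] is uniformly continuous.  Each of the two suprema is
    bounded by the other one since [l] is onto. *)
Lemma dist_continuous_supdist a b g : a <= b -> {within `[a, b], continuous g} ->
  dist_continuous (D1 a b) (d1 a b) (supdist a b g).
Proof.
move=> ab cg f Df e e0.
have e30 : 0 < e / 3 by rewrite divr_gt0.
have [d d0 Hd] := within_continuous_unif cg e30.
exists (Num.min d (e / 3)); first by rewrite lt_min d0.
move=> f' Df' /(d1_lt Df Df')[c]; rewrite lt_min => /andP[cd ce] [l].
move=> [[[lf _ ls] _] lc fl].
have lI t : a <= t <= b -> a <= l t <= b.
  by move=> tab; have := lf t; rewrite /= !in_itv/=; exact.
have gl t : a <= t <= b -> `|g (l t) - g t| < e / 3.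
  by move=> tab; apply: Hd => //; [exact: lI | exact: le_lt_trans (lc _ tab) cd].
suff : `|supdist a b g f - supdist a b g f'| <= e / 3 + e / 3.
  by move=> H; apply: le_lt_trans H _; lra.
rewrite ler_norml; apply/andP; split.
  rewrite lerNl opprB lerBlDr; apply: supdist_le => // t tab.
  have [|u /=] := ls t; first by rewrite /= in_itv.
  rewrite in_itv/= => uab <-.
  rewrite (_ : f' (l u) - g (l u) =
    (f u - g u) - (f u - f' (l u)) - (g (l u) - g u)); last by ring.
  apply: le_trans (ler_normB _ _) _.
  apply: le_trans (lerD (ler_normB _ _) (lexx _)) _.
  have := supdist_ge cg Df uab; have := fl _ uab; have := gl _ uab.
  by move=> *; lra.
rewrite lerBlDr; apply: supdist_le => // u uab.
rewrite (_ : f u - g u =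
    (f u - f' (l u)) + (f' (l u) - g (l u)) + (g (l u) - g u)); last by ring.
apply: le_trans (ler_normD _ _) _.
apply: le_trans (lerD (ler_normD _ _) (lexx _)) _.
have := supdist_ge cg Df' (lI _ uab); have := fl _ uab; have := gl _ uab.
by move=> *; lra.
Qed.

(** The right endpoint is the default value: it is the only time at which a
    cadlag path is not recovered from its values at later rational times. *)
Definition rat_point a b (n : nat) : R :=
  if (unpickle n : option rat) is Some q then
    if a <= ratr q < b then ratr q else b else b.

Lemma rat_pointP a b n : a <= b -> a <= rat_point a b n <= b.
Proof.
rewrite /rat_point => ab; case: unpickle => [q|]; last by rewrite ab lexx.
by case: ifPn => [/andP[-> /ltW]|]//; rewrite ab lexx.
Qed.

(** Right-continuity lets the supremum run over countably many times only, which
    is what makes it measurable for the coordinate sigma-algebra. *)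
Lemma supdist_rat a b g f : a <= b -> {within `[a, b], continuous g} ->
  D1 a b f -> supdist a b g f =
  sups (fun n => `|f (rat_point a b n) - g (rat_point a b n)|) 0%N.
Proof.
move=> ab cg Df; apply/eqP; rewrite eq_le; apply/andP; split; last first.
  apply: sup_le_ub; first by exists `|f (rat_point a b 0) - g (rat_point a b 0)|, 0%N.
  by move=> _ [n _ <-]; apply: supdist_ge => //; exact: rat_pointP.
set S := sups _ _.
have Sn n : `|f (rat_point a b n) - g (rat_point a b n)| <= S.
  apply: ub_le_sup; last by exists n.
  exists (supdist a b g f) => _ [m _ <-].
  by apply: supdist_ge => //; exact: rat_pointP.
have Sq q : a <= ratr q < b -> `|f (ratr q) - g (ratr q)| <= S.
  by move=> qab; have := Sn (pickle q); rewrite /rat_point pickleK qab.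
apply: supdist_le => // t /andP[ta]; rewrite le_eqVlt => /predU1P[->|tb].
  have [|q] := @rat_in_itvoo R b (b + 1); first by rewrite ltrDl.
  rewrite in_itv/= => /andP[bq _].
  by have := Sn (pickle q); rewrite /rat_point pickleK [ratr q < b]ltNge (ltW bq) andbF.
apply/ler_addgt0Pr => e e0; have e20 : 0 < e / 2 by rewrite divr_gt0.
have [d d0 Hd] := within_continuous_unif cg e20.
have [fr _] := Df.
have tab : a <= t < b by rewrite ta tb.
have := @cvgr_dist_lt R R^o _ _ _ f (f t) (fr _ tab) _ e20.
rewrite near_withinE => -[r r0 Hr].
have [|q] := @rat_in_itvoo R t (Num.min b (t + Num.min d r)).
  by rewrite lt_min tb ltrDl lt_min d0.
rewrite in_itv/= lt_min => /andP[tq] /andP[qb].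
rewrite -ltrBlDl lt_min => /andP[qd qr].
have tqE : `|t - ratr q| = ratr q - t by rewrite distrC gtr0_norm// subr_gt0.
have h1 : `|f t - f (ratr q)| < e / 2.
  by apply: Hr => //; rewrite /= tqE.
have h2 : `|g t - g (ratr q)| < e / 2.
  by apply: Hd; rewrite ?tqE// ?ta ?(ltW tb)// (le_trans ta (ltW tq)) ltW.
have /Sq h3 : a <= ratr q < b by rewrite (le_trans ta (ltW tq)).
rewrite (_ : f t - g t = (f t - f (ratr q)) + (f (ratr q) - g (ratr q))
   - (g t - g (ratr q))); last by ring.
apply: le_trans (ler_normB _ _) _.
apply: le_trans (lerD (ler_normD _ _) (lexx _)) _.
lra.
Qed.

End paths.

(** * Coordinate sigma-algebras and test functionals *)

Section path_sigma_algebra.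
Context {R : realType} {I : Type}.
Variables (J : set I) (D : set (I -> R)).

(** The carrier is the type of all functions, and a set is measurable when its
    trace on [D] belongs to the coordinate sigma-algebra of [D].  Thus functionals
    that are only meaningful on [D] become measurable functions on the measurable
    set [D] of a genuine measurable type. *)
Definition path_space := g_sigma_algebraType
  [set C : set (I -> R) | coordinate_sigma_algebra J D (D `&` C)].

(** The sets with a measurable trace already form a sigma-algebra, so that
    generating one adds nothing. *)
Lemma measurable_path_spaceP (C : set path_space) :
  measurable C <-> coordinate_sigma_algebra J D (D `&` C).
Proof.
split; last by move=> DC; exact: sub_sigma_algebra.
suff : <<s [set C : set (I -> R) | coordinate_sigma_algebra J D (D `&` C)] >> `<=`
  [set C | coordinate_sigma_algebra J D (D `&` C)] by exact.
apply: smallest_sub => //; split => /=.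
- by rewrite setI0; apply: sigma_algebra0.
- move=> A DA; rewrite setTD (_ : _ `&` _ = D `\` (D `&` A)).
    exact: sigma_algebraCD.
  by rewrite setDIr setDv set0U setDE.
- move=> F DF; rewrite setI_bigcupr; exact: sigma_algebra_bigcup.
Qed.

Lemma measurable_path_set : measurable (D : set path_space).
Proof.
apply/measurable_path_spaceP; rewrite setIid -[X in coordinate_sigma_algebra _ _ X]setD0.
by apply: sigma_algebraCD; exact: sigma_algebra0.
Qed.

Lemma measurable_fun_pathP (h : path_space -> R) :
  measurable_fun (D : set path_space) h <->
  forall A : set R, measurable A -> coordinate_sigma_algebra J D (D `&` h @^-1` A).
Proof.
split => [mh A mA|mh _ A mA].
  by have /measurable_path_spaceP := mh measurable_path_set A mA; rewrite setIA setIid.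
by apply/measurable_path_spaceP; rewrite setIA setIid; exact: mh.
Qed.

Lemma measurable_coordinate i : J i ->
  measurable_fun (D : set path_space) (fun f : path_space => f i).
Proof.
move=> Ji; apply/measurable_fun_pathP => A mA.
by apply: sub_sigma_algebra; exists i, A.
Qed.

Lemma random_element_coordinates d (Omega : measurableType d) (X : Omega -> I -> R) :
  (forall w, D (X w)) -> (forall i, J i -> measurable_fun setT (fun w => X w i)) ->
  random_element J D X.
Proof.
move=> DX mX; split => // C.
suff : coordinate_sigma_algebra J D `<=` [set C | measurable (X @^-1` C)] by exact.
apply: smallest_sub.
  split => /=.
  - by rewrite preimage_set0.
  - move=> A mA; rewrite (_ : X @^-1` _ = ~` (X @^-1` A)); first exact: measurableC.
    by apply/seteqP; split => w //= [].
  - move=> F mF; rewrite preimage_bigcup; exact: bigcup_measurable.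
move=> _ [i [A [Ji mA ->]]] /=; rewrite preimage_setI.
rewrite (_ : X @^-1` D = setT) ?setTI; last by apply/seteqP; split => // w _; exact: DX.
have := mX i Ji measurableT A mA; rewrite setTI; exact.
Qed.

Lemma measurable_test d (Omega : measurableType d) (X : Omega -> I -> R) (h : (I -> R) -> R) :
  random_element J D X -> measurable_fun (D : set path_space) h ->
  measurable_fun setT (h \o X).
Proof.
move=> [DX mX] /measurable_fun_pathP mh _ A mA; rewrite setTI.
have := mX _ (mh A mA); congr measurable.
by apply/seteqP; split => w //= [].
Qed.

End path_sigma_algebra.

Section test_functionals.
Context {R : realType} {I : Type}.
Variables (J : set I) (D : set (I -> R)) (dist : (I -> R) -> (I -> R) -> R).

Lemma dist_continuous_max h k : dist_continuous D dist h ->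
  dist_continuous D dist k -> dist_continuous D dist (fun f => Num.max (h f) (k f)).
Proof.
move=> ch ck f Df e e0.
have [d1 d10 H1] := ch f Df e e0; have [d2 d20 H2] := ck f Df e e0.
exists (Num.min d1 d2); first by rewrite lt_min d10.
move=> g Dg; rewrite lt_min => /andP[/(H1 _ Dg) + /(H2 _ Dg)].
rewrite !ltr_norml => /andP[? ?] /andP[? ?].
rewrite /Num.max; case: ifPn; case: ifPn; rewrite -?leNgt => *; apply/andP; split; lra.
Qed.

Lemma dist_continuous_affine h c m : dist_continuous D dist h ->
  dist_continuous D dist (fun f => m - c * h f).
Proof.
move=> ch f Df e e0.
have c1 : 0 < `|c| + 1 by rewrite ltr_wpDl.
have [d d0 H] := ch f Df (e / (`|c| + 1)) (divr_gt0 e0 c1).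
exists d => // g Dg /(H _ Dg); rewrite ltr_pdivlMr// => H'.
rewrite (_ : m - c * h f - (m - c * h g) = c * (h g - h f)); last by ring.
rewrite normrM; apply: le_lt_trans H'; rewrite distrC mulrC.
by rewrite ler_wpM2l// lerDl.
Qed.

Lemma dist_continuous_cst m : dist_continuous D dist (fun=> m).
Proof. by move=> f Df e e0; exists 1 => // g _ _; rewrite subrr normr0. Qed.

Lemma test_functional_max h k : test_functional J D dist h -> test_functional J D dist k ->
  test_functional J D dist (fun f => Num.max (h f) (k f)).
Proof.
move=> [[M HM] /measurable_fun_pathP mh ch] [[N HN] /measurable_fun_pathP mk ck]; split.
- exists (Num.max M N) => f Df; rewrite /Num.max; case: ifPn => _.
    by apply: le_trans (HN _ Df) _; rewrite le_max lexx orbT.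
  by apply: le_trans (HM _ Df) _; rewrite le_max lexx.
- by apply/measurable_fun_pathP; exact: measurable_maxr.
- exact: dist_continuous_max.
Qed.

Lemma test_functional_opp h : test_functional J D dist h ->
  test_functional J D dist (fun f => - h f).
Proof.
move=> [[M HM] /measurable_fun_pathP mh ch]; split.
- by exists M => f Df; rewrite normrN HM.
- by apply/measurable_fun_pathP; exact: measurableT_comp.
- move=> f Df e e0; have [d d0 H] := ch f Df e e0; exists d => // g Dg.
  by move=> /(H _ Dg); rewrite -opprD normrN.
Qed.

End test_functionals.

Section cones.
Context {R : realType}.
Variables (a b : R).
Hypothesis ab : a <= b.

(** Cones are the functionals with which the test functional of the target space
    is bounded from below.  The truncation at [- M] keeps them bounded. *)
Lemma test_functional_cone (g : R -> R) M m c :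
  {within `[a, b], continuous g} -> m <= M -> 0 <= c ->
  test_functional `[a, b] (D1 a b) (d1 a b)
    (fun f => Num.max (- M) (m - c * supdist a b g f)).
Proof.
move=> cg mM c0; split.
- exists `|M| => f Df.
  have := supdist_ge0 ab cg Df => sg.
  have H : m - c * supdist a b g f <= `|M|.
    by rewrite lerBlDr (le_trans mM)// (le_trans (ler_norm _))// lerDl mulr_ge0.
  rewrite /Num.max; case: ifPn => [H1|_]; last by rewrite normrN.
  by rewrite ler_norml H andbT (le_trans _ (ltW H1))// lerN2 ler_norm.
- suff : measurable_fun (D1 a b : set (path_space `[a, b] (D1 a b)))
      (fun f => Num.max (- M) (m - c * supdist a b g f)).
    by move/measurable_fun_pathP.
  apply: measurable_maxr => //; apply: measurable_funB => //; apply: measurable_funM => //.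
  apply: (eq_measurable_fun (fun f : path_space `[a, b] (D1 a b) => sups
      (fun n => `|f (rat_point a b n) - g (rat_point a b n)|) 0%N)).
    by move=> f0; rewrite inE => Df; rewrite supdist_rat.
  apply: (@measurable_fun_sups _ _ R (D1 a b : set (path_space `[a, b] (D1 a b)))
      (fun n (f : path_space `[a, b] (D1 a b)) =>
         `|f (rat_point a b n) - g (rat_point a b n)|)).
    move=> f Df; exists (supdist a b g f) => _ [n _ <-].
    by apply: supdist_ge => //; exact: rat_pointP.
  move=> n; apply: measurableT_comp => //; apply: measurable_funB => //.
  by apply: measurable_coordinate; rewrite /= in_itv/= rat_pointP.
- apply: dist_continuous_max; first exact: dist_continuous_cst.
  by apply: dist_continuous_affine; exact: dist_continuous_supdist.
Qed.

End cones.

(** * Expectations of bounded functions *)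

Section bounded_expectation.
Context {R : realType} d (Omega : measurableType d) (P : probability Omega R).

Lemma bounded_integrable (X : Omega -> R) (M : R) : measurable_fun setT X ->
  (forall w, `|X w| <= M) -> P.-integrable setT (EFin \o X).
Proof.
move=> mX XM; apply: measurable_bounded_integrable => //.
  by have := fin_num_measure P _ (@measurableT _ Omega); rewrite fin_numE => /andP[_]; rewrite ltey.
by exists M; split; [exact: num_real | move=> N MN w _; exact: le_trans (XM w) (ltW MN)].
Qed.

Lemma expectation_bounded_fin_num (X : Omega -> R) (M : R) : measurable_fun setT X ->
  (forall w, `|X w| <= M) -> ('E_P[X])%E \is a fin_num.
Proof.
by move=> mX XM; rewrite unlock; apply: integrable_fin_num => //; exact: bounded_integrable XM.
Qed.

Lemma expectation_bounded_le (X Y : Omega -> R) (M N e : R) :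
  measurable_fun setT X -> (forall w, `|X w| <= M) ->
  measurable_fun setT Y -> (forall w, `|Y w| <= N) ->
  (forall w, X w <= Y w + e) ->
  fine ('E_P[X])%E <= fine ('E_P[Y])%E + e.
Proof.
move=> mX XM mY YN XY.
have iX := bounded_integrable mX XM; have iY := bounded_integrable mY YN.
have mYe : measurable_fun setT (fun w => Y w + e) by apply: measurable_funD.
have iYe : P.-integrable setT (EFin \o (fun w => Y w + e)).
  apply: (bounded_integrable mYe (M := N + `|e|)) => w.
  by rewrite (le_trans (ler_normD _ _))// lerD2r.
have -> : fine ('E_P[Y])%E + e = fine ('E_P[fun w => (Y w + e)%R])%E.
  rewrite !unlock (_ : \int[P]_w (Y w + e)%R%:E = \int[P]_w (Y w)%:E + e%:E)%E.
    by rewrite [RHS]fineD//; exact: (integrable_fin_num measurableT iY).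
  under eq_integral do rewrite EFinD.
  rewrite integralD//; last by apply: (bounded_integrable (M := `|e|)).
  by rewrite integral_cst//= probability_setT mule1.
rewrite !unlock; apply: fine_le; [exact: integrable_fin_num..|].
by apply: le_integral => // w _; rewrite lee_fin.
Qed.

Lemma expectation_bounded_cvg (X_ : nat -> Omega -> R) (X : Omega -> R) (M : R) :
  (forall n, measurable_fun setT (X_ n)) -> (forall n w, `|X_ n w| <= M) ->
  measurable_fun setT X -> 
  (forall w, X_ n w @[n --> \oo] --> X w) ->
  (fine ('E_P[X_ n])%E @[n --> \oo] --> fine ('E_P[X])%E).
Proof.
move=> mX_ XM mX X_X.
rewrite unlock.
have [] := @dominated_convergence _ Omega R P setT measurableT
  (fun n => EFin \o X_ n) (EFin \o X) (cst M%:E).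
- by move=> n; apply/measurable_EFinP.
- exact/measurable_EFinP.
- by apply: aeW => w _; apply: cvg_EFin; [exact: nearW|exact: X_X].
- apply: (bounded_integrable (X := cst M) (M := `|M|)) => //.
- by apply: aeW => w n _ /=; rewrite lee_fin.
- move=> iX _ H; apply: fine_cvg; rewrite fineK//.
  exact: (integrable_fin_num measurableT iX).
Qed.

End bounded_expectation.

(** * Lipschitz minorants of a functional *)

Section lipschitz_envelope.
Context {R : realType} {I : Type}.
Variables (J : set I) (D : set (I -> R)) (dist : (I -> R) -> (I -> R) -> R).
Implicit Types (x y : I -> R) (L c e : R).
Hypothesis dist_le : forall f g c, 0 < c ->
  (forall i, J i -> `|f i - g i| <= c) -> dist f g <= c.

(** The infimal convolution of [h] with [L] times the uniform distance on [J].
    The distance enters through all its upper bounds [c], so that elements at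
    infinite distance from [y] are simply left out. *)
Definition lipschitz_envelope (h : (I -> R) -> R) (L : R) (y : I -> R) :=
  inf [set z | exists (x : I -> R) (c : R), [/\ D x, 0 <= c,
    forall i, J i -> `|x i - y i| <= c & z = h x + L * c]].

Variables (h : (I -> R) -> R) (M : R).
Hypothesis hM : forall f, D f -> `|h f| <= M.

Lemma lipschitz_envelope_le L x y c : 0 <= L -> D x -> 0 <= c ->
  (forall i, J i -> `|x i - y i| <= c) -> lipschitz_envelope h L y <= h x + L * c.
Proof.
move=> L0 Dx c0 xy; apply: ge_inf; last by exists x, c.
exists (- M) => _ [x' [c' [/hM + c'0 _ ->]]].
rewrite ler_norml => /andP[+ _] => /le_trans; apply.
by rewrite lerDl mulr_ge0.
Qed.

Lemma lipschitz_envelope_ub L y : 0 <= L -> D y -> lipschitz_envelope h L y <= M.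
Proof.
move=> L0 Dy; apply: le_trans (lipschitz_envelope_le L0 Dy (lexx 0) _) _.
  by move=> i _; rewrite subrr normr0.
by rewrite mulr0 addr0 (le_trans (ler_norm _))// hM.
Qed.

(** Elements close to [y] have values above [h y - e] by continuity of [h].  For
    those at distance at least [r / 3] from [y'] the penalty [L * c] is at least [2 * M],
    the largest possible variation of [h].  The estimate has to hold in a whole
    neighbourhood of [y], because the apex of a cone will only approximate the
    path under consideration. *)
Lemma lipschitz_envelope_approx y e : dist_continuous D dist h -> D y -> 0 < e ->
  exists (n : nat) (d : R), 0 < d /\ forall y', D y' ->
    (forall i, J i -> `|y i - y' i| <= d) -> h y - e <= lipschitz_envelope h n%:R y'.
Proof.
move=> ch Dy e0; have [r r0 Hr] := ch y Dy e e0.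
have M0 : 0 <= M by apply: le_trans (hM Dy).
exists (Num.truncn (2 * M / (r / 3))).+1, (r / 3); split; first by rewrite divr_gt0.
move=> y' Dy' yy'; set L := _.+1.
have LM : 2 * M <= L%:R * (r / 3).
  by rewrite -ler_pdivrMr ?divr_gt0//; apply/ltW/truncnS_gt.
apply: lb_le_inf.
  by exists (h y' + L%:R * 0), y', 0; split => // i _; rewrite subrr normr0.
move=> _ [x [c [Dx c0 xy' ->]]].
have [cr|cr] := ltP c (r / 3).
  have : dist y x < r.
    have rr : 2 * (r / 3) < r by lra.
    apply: le_lt_trans rr; apply: dist_le; first by lra.
    move=> i Ji; rewrite (_ : y i - x i = (y i - y' i) - (x i - y' i)); last by ring.
    apply: le_trans (ler_normB _ _) _.
    by have := yy' i Ji; have := xy' i Ji; lra.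
  move=> /(Hr _ Dx); rewrite ltr_norml => /andP[_ +].
  have : 0 <= L%:R * c by rewrite mulr_ge0.
  lra.
have := hM Dx; have := hM Dy; rewrite !ler_norml => /andP[_ h1] /andP[h2 _].
have : L%:R * (r / 3) <= L%:R * c by rewrite ler_wpM2l.
lra.
Qed.

End lipschitz_envelope.

(** * A countable dense family of continuous functions *)

Section countable_dense.
Context {R : realType}.

(** The upper envelope of tents of slope [K] standing at the points [j / N], with
    tops at the heights [z_j / N].  Such functions are continuous and are coded by
    two naturals and a list of integers. *)
Definition tent_max (K N : nat) (z : seq int) (t : R) : R :=
  \big[Num.max/ - K%:R]_(j < size z)
    ((z`_j)%:~R / N%:R - K%:R * `|t - j%:R / N%:R|).

Lemma tent_max_lipschitz K N z t u :
  tent_max K N z t <= tent_max K N z u + K%:R * `|t - u|.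
Proof.
apply: bigmax_le => [|j _].
  apply: le_trans (_ : tent_max K N z u <= _); last by rewrite lerDl mulr_ge0.
  exact: bigmax_ge_id.
apply: le_trans (lerD (le_bigmax _ _ j) (lexx _)).
have H : `|u - j%:R / N%:R| <= `|t - j%:R / N%:R| + `|t - u|.
  rewrite (_ : u - _ = (t - j%:R / N%:R) - (t - u)); last by ring.
  exact: ler_normB.
have : K%:R * `|u - j%:R / N%:R| <= K%:R * (`|t - j%:R / N%:R| + `|t - u|).
  by rewrite ler_wpM2l.
rewrite mulrDr; lra.
Qed.

Lemma continuous_tent_max K N z : continuous (tent_max K N z).
Proof.
move=> t; apply/(@cvgrPdist_lt _ R^o) => e e0.
have K1 : 0 < K%:R + 1 :> R by rewrite ltr_wpDl.
near=> u.
have : `|t - u| < e / (K%:R + 1).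
  by near: u; exists (e / (K%:R + 1)) => //=; rewrite divr_gt0.
rewrite ltr_pdivlMr// => tu.
have h1 := tent_max_lipschitz K N z t u; have h2 := tent_max_lipschitz K N z u t.
apply: le_lt_trans tu; rewrite mulrDr mulr1 mulrC ler_wpDr//.
by rewrite ler_norml; rewrite (distrC u t) in h2; apply/andP; split; lra.
Unshelve. all: by end_near. Qed.

(** The heights are the values of [f] rounded to multiples of [1 / N].  If [K] is
    large, a tent standing at distance [d] or more of [t] lies below [- M] there
    and does not count; the other ones have tops close to [f t], by uniform
    continuity.  The nearest tent on the left loses at most [K / N] between its
    top and [t]. *)
Lemma tent_max_dense (f : R -> R) (e : R) : {within `[0, 1], continuous f} -> 0 < e ->
  exists K N z, forall t, 0 <= t <= 1 -> `|f t - tent_max K N z t| <= e.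
Proof.
move=> cf e0; have e30 : 0 < e / 3 by rewrite divr_gt0.
have [d d0 Hd] := within_continuous_unif cf e30.
have [M HM] := within_continuous_bounded cf.
have M0 : 0 <= M by apply: le_trans (HM 0 _); rewrite ?lexx ?ler01.
pose K := (Num.truncn (M + 2 * M / d)).+1.
have KM : M + 2 * M / d <= K%:R by exact/ltW/truncnS_gt.
have KM1 : M <= K%:R by apply: le_trans KM; rewrite lerDl divr_ge0 ?mulr_ge0// ltW.
have KM2 : 2 * M <= K%:R * d.
  by rewrite -ler_pdivrMr//; apply: le_trans KM; rewrite lerDr.
pose N := (Num.truncn (1 / d + K%:R / (e / 3) + 1 / (e / 3))).+1.
have N0 : 0 < N%:R :> R by rewrite ltr0n.
have NB : 1 / d + K%:R / (e / 3) + 1 / (e / 3) < N%:R by exact: truncnS_gt.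
have p1 : 0 <= 1 / d by rewrite divr_ge0// ltW.
have p2 : 0 <= K%:R / (e / 3) by rewrite divr_ge0// ltW.
have p3 : 0 <= 1 / (e / 3) by rewrite divr_ge0// ltW.
have Nd : 1 / N%:R < d.
  by rewrite ltr_pdivrMr// -ltr_pdivrMl// mulrC -[_^-1]mul1r mulrA mulr1; lra.
have NK : K%:R / N%:R < e / 3.
  by rewrite ltr_pdivrMr// mulrC -ltr_pdivrMr//; lra.
have Ne : 1 / N%:R < e / 3.
  by rewrite ltr_pdivrMr// mulrC -ltr_pdivrMr//; lra.
pose z : seq int := mkseq (fun j => Num.floor (N%:R * f (j%:R / N%:R))) N.+1.
have sz : size z = N.+1 by rewrite size_mkseq.
have jI j : (j < N.+1)%N -> 0 <= (j%:R / N%:R : R) <= 1.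
  by move=> jN; rewrite divr_ge0//= ler_pdivrMr// mul1r ler_nat.
have zj j : (j < N.+1)%N -> f (j%:R / N%:R) - 1 / N%:R < (z`_j)%:~R / N%:R <= f (j%:R / N%:R).
  move=> jN; rewrite nth_mkseq//; set y := f _.
  rewrite ltr_pdivlMr// ler_pdivrMr// mulrBl divfK ?gt_eqF//.
  have /andP[h1] := floor_itv (N%:R * y); rewrite intrD [y * _]mulrC => h2.
  by rewrite h1 andbT ltrBlDr.
exists K, N, z => t t01.
have ft := HM _ t01; rewrite ler_norml in ft; case/andP: ft => ft1 ft2.
rewrite ler_norml; apply/andP; split.
  rewrite lerNl opprB lerBlDr; apply: bigmax_le => [|j _]; first lra.
  have jN : (j < N.+1)%N by rewrite -sz.
  have /andP[_ zle] := zj _ jN.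
  have [tj|tj] := ltP `|t - j%:R / N%:R| d.
    have := Hd _ _ t01 (jI _ jN) tj.
    have : 0 <= K%:R * `|t - j%:R / N%:R| by rewrite mulr_ge0.
    by rewrite ltr_norml => ? /andP[? ?]; lra.
  have : K%:R * d <= K%:R * `|t - j%:R / N%:R| by rewrite ler_wpM2l.
  have := HM _ (jI _ jN); rewrite ler_norml => /andP[? ?]; lra.
have Nt0 : 0 <= N%:R * t by case/andP: t01 => ? _; rewrite mulr_ge0.
pose j := Num.truncn (N%:R * t).
have /andP[jt tj] := truncn_itv Nt0; rewrite -/j in jt tj.
have jN : (j < N.+1)%N.
  rewrite ltnS -(ler_nat R) (le_trans jt)// ler_piMr//; by case/andP: t01.
have tjN : `|t - j%:R / N%:R| <= 1 / N%:R.
  rewrite ger0_norm; last by rewrite subr_ge0 ler_pdivrMr// mulrC.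
  by rewrite lerBlDr -mulrDl ler_pdivlMr// mulrC; apply/ltW; move: tj; rewrite -natr1 addrC.
have jz : (j < size z)%N by rewrite sz.
have := le_bigmax (- K%:R)
  (fun j : 'I_(size z) => (z`_j)%:~R / N%:R - K%:R * `|t - j%:R / N%:R|)
  (Ordinal jz).
rewrite -/(tent_max K N z t) /= => T1.
have /andP[zge _] := zj _ jN.
have := Hd _ _ t01 (jI _ jN) (le_lt_trans tjN Nd); rewrite ltr_norml => /andP[? ?].
have : K%:R * `|t - j%:R / N%:R| <= K%:R * (1 / N%:R) by rewrite ler_wpM2l.
rewrite mulrA mulr1; lra.
Qed.

Lemma countable_dense_continuous : exists g : nat -> R -> R,
  (forall n, {within `[0, 1], continuous (g n)}) /\
  forall (f : R -> R) (e : R), {within `[0, 1], continuous f} -> 0 < e ->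
    exists n, forall t, 0 <= t <= 1 -> `|f t - g n t| <= e.
Proof.
pose g n := if unpickle n is Some (K, N, z) then tent_max K N z else tent_max 0 0 [::].
exists g; split.
  move=> n; apply: continuous_subspaceT; rewrite /g.
  by case: unpickle => [[[K N] z]|]; exact: continuous_tent_max.
move=> f e cf e0; have [K [N [z H]]] := tent_max_dense cf e0.
by exists (pickle (K, N, z)); rewrite /g pickleK.
Qed.

End countable_dense.

(** * Transfer of weak convergence when the limit has continuous paths *)

(** A substitute for the continuous mapping theorem.  [Phi] is meaningful along
    continuous paths only; [X_Phi] therefore compares [X n] with the images of
    continuous paths [g], at the cost of the distance from [S n] to [g]. *)
Section transfer.
Context {R : realType} {I : Type}.
Variables (J : set I) (D : set (I -> R)) (dist : (I -> R) -> (I -> R) -> R).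
Hypothesis dist_le : forall f g (c : R), 0 < c ->
  (forall i, J i -> `|f i - g i| <= c) -> dist f g <= c.
Context d (Omega : measurableType d) (P : probability Omega R).
Context d' (Omega' : measurableType d') (P' : probability Omega' R).
Variables (S : nat -> Omega -> R -> R) (W : Omega' -> R -> R).
Hypothesis SW : weak_cvg `[0, 1] (D1 0 1) (d1 0 1) P P' S W.
Hypothesis cW : forall w, {within `[0, 1], continuous (W w)}.
Arguments cW w : clear implicits.
Variables (Phi : (R -> R) -> I -> R) (C : R).
Hypothesis C0 : 0 <= C.
Hypothesis D_Phi : forall g : R -> R, {within `[0, 1], continuous g} -> D (Phi g).
Hypothesis Phi_lipschitz : forall (f g : R -> R) (c : R), {within `[0, 1], continuous f} ->
  {within `[0, 1], continuous g} ->
  (forall t, 0 <= t <= 1 -> `|f t - g t| <= c) ->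
  forall i, J i -> `|Phi f i - Phi g i| <= C * c.
Variables (X : nat -> Omega -> I -> R).
Hypothesis rX : forall n, random_element J D (X n).
Hypothesis rPhiW : random_element J D (fun w => Phi (W w)).
Hypothesis X_Phi : forall g : R -> R, {within `[0, 1], continuous g} -> forall e : R, 0 < e ->
  exists N, forall n, (N <= n)%N -> forall w i, J i ->
    `|X n w i - Phi g i| <= C * supdist 0 1 g (S n w) + e.

Section lower_bound.
Variable h : (I -> R) -> R.
Hypothesis hT : test_functional J D dist h.
Variable M : R.
Hypothesis hM : forall f, D f -> `|h f| <= M.
Variable g : nat -> R -> R.
Hypothesis cg : forall n, {within `[0, 1], continuous (g n)}.
Arguments cg n : clear implicits.
Hypothesis dense_g : forall (f : R -> R) (e : R), {within `[0, 1], continuous f} -> 0 < e ->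
  exists n, forall t, 0 <= t <= 1 -> `|f t - g n t| <= e.

(* Every pair of a slope and a center occurs, so that the running maximum of the
   cones reaches any given one. *)
Let index k : nat * nat := if unpickle k is Some ln then ln else (0%N, 0%N).
Let slope k : R := (index k).1%:R.
Let center k := g (index k).2.
Let height k := lipschitz_envelope J D h (slope k) (Phi (center k)).

Let cone k f := Num.max (- M) (height k - slope k * C * supdist 0 1 (center k) f).
Let cones := fix cones n f := if n is k.+1 then Num.max (cones k f) (cone k f) else cone 0%N f.

Let slope0 k : 0 <= slope k. Proof. exact: ler0n. Qed.

Let cone_test k : test_functional `[0, 1] (D1 0 1) (d1 0 1) (cone k).
Proof.
apply: test_functional_cone => //; first exact: cg.
  by rewrite /height; apply: (lipschitz_envelope_ub J hM) => //; apply: D_Phi; exact: cg.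
by rewrite mulr_ge0.
Qed.

Let cones_test n : test_functional `[0, 1] (D1 0 1) (d1 0 1) (cones n).
Proof.
elim: n => [|n IH] /=; first exact: cone_test.
by apply: test_functional_max => //; exact: cone_test.
Qed.

Let cones_bounded n f : D1 0 1 f -> `|cones n f| <= M.
Proof.
move=> Df.
have M0 : 0 <= M by exact: le_trans (normr_ge0 _) (hM (D_Phi (cg 0%N))).
have ck k : - M <= cone k f <= M.
  rewrite /cone le_max lexx/= ge_max ge0_cp//=.
  rewrite lerBlDr (le_trans (lipschitz_envelope_ub J hM _ _))//.
    by apply: D_Phi; exact: cg.
  by rewrite lerDl !mulr_ge0// supdist_ge0//; exact: cg.
rewrite ler_norml; elim: n => [|n /andP[IH1 IH2]] /=; first exact: ck.
by have /andP[? ?] := ck n; rewrite le_max IH1/= ge_max IH2.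
Qed.

Let cone_le k f y e : D y -> 0 <= e -> D1 0 1 f ->
  (forall i, J i -> `|y i - Phi (center k) i| <= C * supdist 0 1 (center k) f + e) ->
  cone k f <= h y + slope k * e.
Proof.
move=> Dy e0 Df H; rewrite /cone ge_max; apply/andP; split.
  have := hM Dy; rewrite ler_norml => /andP[+ _] => /le_trans; apply.
  by rewrite lerDl mulr_ge0.
rewrite lerBlDr; apply: le_trans (lipschitz_envelope_le hM (slope0 k) Dy _ H) _.
  by rewrite addr_ge0// mulr_ge0// supdist_ge0//; exact: cg.
by rewrite mulrDr mulrA -!addrA lerD2l addrC.
Qed.

Let cones_le n f b : (forall k, cone k f <= b) -> cones n f <= b.
Proof. by move=> H; elim: n => [|n IH] /=; [exact: H | rewrite ge_max IH; exact: H]. Qed.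

(** Finitely many cones only are compared with [h], so that a single [N] serves
    for all of them, uniformly in [w]. *)
Let cones_S n (e : R) : 0 < e -> exists N, forall T, (N <= T)%N -> forall w,
  cones n (S T w) <= h (X T w) + e.
Proof.
move=> e0; have [rS _ _] := SW.
have ck k : exists N, forall T, (N <= T)%N -> forall w, cone k (S T w) <= h (X T w) + e.
  have s1 : 0 < slope k + 1 by rewrite ltr_wpDl.
  have [N HN] := X_Phi (cg (index k).2) (divr_gt0 e0 s1).
  exists N => T NT w.
  apply: le_trans (cone_le (e := e / (slope k + 1)) _ _ _ _) _.
  - by case: (rX T).
  - by rewrite divr_ge0// ltW.
  - by case: (rS T).
  - exact: HN.
  rewrite lerD2l mulrCA; apply: ler_piMr; first exact: ltW.
  by rewrite ler_pdivrMr// mul1r lerDl.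
elim: n => [|n [N1 IH]] /=; first exact: ck.
have [N2 H2] := ck n; exists (maxn N1 N2) => T; rewrite geq_max => /andP[T1 T2] w.
by rewrite ge_max IH//= H2.
Qed.

Let cones_W_le n w : cones n (W w) <= h (Phi (W w)).
Proof.
have [_ [DW _] _] := SW.
apply: cones_le => k; rewrite -[h _]addr0 -(mulr0 (slope k)).
apply: cone_le => //; first exact: D_Phi.
move=> i Ji; rewrite addr0; apply: Phi_lipschitz => //; first exact: cg.
by move=> t t01; apply: supdist_ge => //; exact: cg.
Qed.

(** The slope [L] is chosen first, according to the modulus of continuity of [h]
    at [Phi (W w)]; only then is the center taken so close to [W w] that the cone
    of slope [L * C] loses little between its apex and [W w]. *)
Let cones_W_ge w (e : R) : 0 < e ->
  exists n0, forall n, (n0 <= n)%N -> h (Phi (W w)) - e <= cones n (W w).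
Proof.
move=> e0; have e20 : 0 < e / 2 by rewrite divr_gt0.
have [_ _ ch] := hT; have DPW := D_Phi (cW w).
have [L [r [r0 HL]]] := lipschitz_envelope_approx dist_le hM ch DPW e20.
have LC : 0 < L%:R * C + 1 :> R by rewrite ltr_wpDl// mulr_ge0.
have C1 : 0 < C + 1 by rewrite ltr_wpDl.
(* [C + 1] and [L%:R * C + 1] only avoid divisions by zero. *)
pose c := Num.min (r / (C + 1)) (e / 2 / (L%:R * C + 1)).
have c0 : 0 < c by rewrite lt_min !divr_gt0.
have [m Hm] := dense_g (cW w) c0.
exists (pickle (L, m)).+1 => n kn.
pose k := pickle (L, m).
have ik : index k = (L, m) by rewrite /index pickleK.
have : cone k (W w) <= cones n (W w).
  elim: n kn => // n IH; rewrite ltnS leq_eqVlt => /predU1P[<-|/IH H] /=.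
    by rewrite le_max lexx orbT.
  by rewrite le_max H.
apply: le_trans; rewrite /cone le_max; apply/orP; right.
have sc : slope k = L%:R by rewrite /slope ik.
have cc : center k = g m by rewrite /center ik.
have : h (Phi (W w)) - e / 2 <= height k.
  rewrite /height sc cc; apply: HL; first exact: D_Phi.
  move=> i Ji; apply: le_trans (Phi_lipschitz _ _ Hm _) _ => //.
  have : C * c <= (C + 1) * (r / (C + 1)).
    apply: ler_pM => //; [exact: ltW|by rewrite lerDl|].
    by rewrite /c ge_min lexx.
  by rewrite [(C + 1) * _]mulrC divfK ?gt_eqF.
have : slope k * C * supdist 0 1 (center k) (W w) <= e / 2.
  rewrite sc cc; apply: (@le_trans _ _ ((L%:R * C + 1) * (e / 2 / (L%:R * C + 1)))).
    apply: ler_pM; [by rewrite mulr_ge0| |by rewrite lerDl|].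
      by have [_ [DW _] _] := SW; apply: supdist_ge0.
    apply: le_trans (supdist_le _ Hm) _ => //.
    by rewrite /c ge_min lexx orbT.
  by rewrite mulrC divfK ?gt_eqF.
lra.
Qed.

(** One half of the convergence.  The other half is this statement for [- h],
    which is a test functional as well. *)
Lemma expectation_lower_bound (e : R) : 0 < e -> exists N, forall T, (N <= T)%N ->
  fine ('E_P'[fun w => h (Phi (W w))])%E <= fine ('E_P[h \o X T])%E + e.
Proof.
move=> e0; have e40 : 0 < e / 4 by rewrite divr_gt0.
have [rS rW wS] := SW.
have [_ /measurable_fun_pathP mh _] := hT.
have mc n : measurable_fun (D1 0 1 : set (path_space `[0, 1] (D1 0 1))) (cones n).
  by apply/measurable_fun_pathP; case: (cones_test n).
have mcW n : measurable_fun setT (cones n \o W) := measurable_test rW (mc n).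
have mcS n T : measurable_fun setT (cones n \o S T) := measurable_test (rS T) (mc n).
have mhX T : measurable_fun setT (h \o X T) := measurable_test (rX T) mh.
have mhW := measurable_test rPhiW mh.
have bcW n w : `|(cones n \o W) w| <= M by apply: cones_bounded; case: rW.
have bcS n T w : `|(cones n \o S T) w| <= M by apply: cones_bounded; case: (rS T).
have bhX T w : `|(h \o X T) w| <= M by apply: hM; case: (rX T).
have cvgW := @expectation_bounded_cvg R _ _ P' (fun n => cones n \o W) _ M mcW bcW mhW.
have /cvgW/(@cvgrPdist_lt _ R^o)/(_ _ e40)[n _ Hn] : forall w,
    (cones n \o W) w @[n --> \oo] --> h (Phi (W w)).
  move=> w; apply/(@cvgrPdist_le _ R^o) => r r0.
  have [n0 Hn0] := cones_W_ge w r0; exists n0 => // n /= nn.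
  rewrite ger0_norm ?subr_ge0 ?cones_W_le//.
  by have := Hn0 n nn; lra.
have := Hn n (leqnn n); rewrite /= ltr_norml => /andP[_ h1].
have [_ _ /(_ _ (cones_test n))] := SW.
rewrite -(fineK (expectation_bounded_fin_num P' (mcW n) (bcW n))).
move=> /fine_cvgP[_] /(@cvgrPdist_lt _ R^o)/(_ _ e40)[N1 _ HN1].
have [N2 HN2] := cones_S n e40.
exists (maxn N1 N2) => T; rewrite geq_max => /andP[T1 T2].
have := HN1 T T1; rewrite /= ltr_norml => /andP[_ h2].
have := expectation_bounded_le P (mcS n T) (bcS n T) (mhX T) (bhX T) (HN2 T T2).
move: h1 h2; rewrite /comp => h1 h2 h3.
lra.
Qed.

End lower_bound.

(** The lower bounds for [h] and for [- h] enclose the expectation of [h \o X T]. *)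
Theorem weak_cvg_transfer : weak_cvg J D dist P P' X (fun w => Phi (W w)).
Proof.
split => // h hT.
have [g [cg dense_g]] := @countable_dense_continuous R.
have hTN := test_functional_opp hT.
have [[M HM] /measurable_fun_pathP mh _] := hT.
have HMN f : D f -> `|- h f| <= M by rewrite normrN; exact: HM.
have mhX T : measurable_fun setT (h \o X T) := measurable_test (rX T) mh.
have mhW := measurable_test rPhiW mh.
have bhX T w : `|(h \o X T) w| <= M by apply: HM; case: (rX T).
have bhW w : `|h (Phi (W w))| <= M by apply: HM; case: rPhiW.
have fX T := expectation_bounded_fin_num P (mhX T) (bhX T).
have fW := expectation_bounded_fin_num P' mhW bhW.
rewrite -(fineK fW); apply: cvg_EFin; first exact: nearW.
apply/(@cvgrPdist_le _ R^o) => e e0.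
have [N1 H1] := expectation_lower_bound hT HM cg dense_g e0.
have [N2 H2] := expectation_lower_bound hTN HMN cg dense_g e0.
have EN d1 (O : measurableType d1) (Q : probability O R) (Z : O -> R) :
  measurable_fun setT Z -> (forall w, `|Z w| <= M) ->
  fine ('E_Q[fun w => (- Z w)%R])%E = - fine ('E_Q[Z])%E.
  move=> mZ bZ; rewrite unlock; under eq_integral do rewrite EFinN.
  rewrite integralN ?fineN//; apply: integrable_add_def => //.
  exact: bounded_integrable bZ.
exists (maxn N1 N2) => // T /=; rewrite geq_max => /andP[/H1 + /H2].
rewrite (EN _ _ P (h \o X T))// (EN _ _ P' (h \o (fun w => Phi (W w))))//.
by rewrite ler_norml /comp => h1 h2; apply/andP; split; lra.
Qed.

End transfer.

(** * Riemann sums *)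

Section riemann.
Context {R : realType}.
Notation mu := (@lebesgue_measure R).
Implicit Types (g : R -> R) (s t c e : R).

Definition primitive g s : R := \int[mu]_(u in `[0, s]) g u.

Lemma within_sub g a b s t : a <= s -> t <= b ->
  {within `[a, b], continuous g} -> {within `[s, t], continuous g}.
Proof.
move=> as_ tb; apply: continuous_subspaceW => u /=; rewrite !in_itv/= => /andP[su ut].
by rewrite (le_trans as_ su) (le_trans ut tb).
Qed.

Lemma primitive_increment g s t c e : {within `[0, 1], continuous g} ->
  0 <= s -> s <= t -> t <= 1 -> (forall u, s <= u <= t -> `|g u - c| <= e) ->
  `|primitive g t - primitive g s - c * (t - s)| <= e * (t - s).
Proof.
move=> cg s0 st t1 H.
have ig a b : 0 <= a -> b <= 1 -> mu.-integrable `[a, b] (EFin \o g).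
  move=> a0 b1; apply: continuous_compact_integrable; first exact: segment_compact.
  exact: within_sub cg.
have i0t := ig 0 t (lexx 0) t1.
have sub : [set` Interval (BRight s) (BRight t)] `<=` `[s, t].
  by move=> u /=; rewrite !in_itv/= => /andP[/ltW -> ->].
have ist : mu.-integrable `]s, t] (EFin \o g).
  apply: integrableS (ig s t s0 t1) => //.
have icst c' : mu.-integrable `]s, t] (EFin \o cst c').
  have ic : mu.-integrable `[s, t] (EFin \o cst c').
    apply: continuous_compact_integrable; first exact: segment_compact.
    by apply: continuous_subspaceT => u; exact: cvg_cst.
  by apply: integrableS ic => //; exact: measurable_itv.
have cstE c' : \int[mu]_(u in `]s, t]) c' = c' * (t - s).
  rewrite Rintegral_cst; [|exact: measurable_itv].
  rewrite /= lebesgue_measure_itv/= lte_fin; case: ltP => // ts.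
  by rewrite (_ : t = s) ?subrr//; apply/le_anti; rewrite st ts.
rewrite /primitive Rintegral_itvB//; [|by rewrite bnd_simp..].
rewrite -cstE -RintegralB//; last exact: (icst c).
have isub : mu.-integrable `]s, t] (EFin \o (fun u => g u - c)).
  by apply: eq_integrable (integrableB _ ist (icst c)) => //.
apply: le_trans (le_normr_Rintegral _ isub) _ => //.
rewrite -cstE; apply: le_Rintegral => //.
- exact: (integrable_abse isub).
- exact: (icst e).
- by move=> u /sub/=; rewrite in_itv/=; exact: H.
Qed.

Lemma primitive0 g : primitive g 0 = 0.
Proof. by rewrite /primitive set_itv1 Rintegral_set1. Qed.

Lemma primitive_lipschitz g s t (M : R) : {within `[0, 1], continuous g} ->
  (forall u, 0 <= u <= 1 -> `|g u| <= M) ->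
  0 <= s -> s <= t -> t <= 1 -> `|primitive g t - primitive g s| <= M * (t - s).
Proof.
move=> cg gM s0 st t1.
have := @primitive_increment g s t 0 M cg s0 st t1; rewrite mul0r !subr0; apply.
move=> u /andP[su ut]; rewrite subr0 gM//.
by rewrite (le_trans s0 su) (le_trans ut t1).
Qed.

(** The threshold [N] depends on [g] and [e] but not on the upper limit [s]. *)
Lemma riemann_sum g e : {within `[0, 1], continuous g} -> 0 < e ->
  exists N, forall T, (N <= T)%N -> forall s, 0 <= s <= 1 ->
  `|T%:R^-1 * \sum_(i < Num.truncn (T%:R * s)) g (i.+1%:R / T%:R) - primitive g s| <= e.
Proof.
move=> cg e0; have e20 : 0 < e / 2 by rewrite divr_gt0.
have [d d0 Hd] := within_continuous_unif cg e20.
have [M HM] := within_continuous_bounded cg.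
have M0 : 0 <= M.
  by apply: le_trans (normr_ge0 (g 0)) (HM 0 _); rewrite lexx ler01.
pose N := (Num.truncn (1 / d + M / (e / 2))).+1.
exists N => T NT s /andP[s0 s1].
have T0 : 0 < T%:R :> R by rewrite ltr0n (leq_trans _ NT).
have NB : 1 / d + M / (e / 2) < T%:R.
  by apply: lt_le_trans (truncnS_gt _) _; rewrite ler_nat.
have p1 : 0 <= 1 / d by rewrite divr_ge0// ltW.
have p2 : 0 <= M / (e / 2) by rewrite divr_ge0// ltW.
have Td : 1 / T%:R < d.
  by rewrite ltr_pdivrMr// mulrC -ltr_pdivrMr//; lra.
have TM : M / T%:R <= e / 2.
  by rewrite ler_pdivrMr// mulrC -ler_pdivrMr//; lra.
have Ts0 : 0 <= T%:R * s by rewrite mulr_ge0.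
have /andP[kT Tk] := truncn_itv Ts0.
set k := Num.truncn _ in kT Tk *.
have ks : k%:R / T%:R <= s by rewrite ler_pdivrMr// mulrC.
have H j : (j <= k)%N ->
  `|T%:R^-1 * \sum_(i < j) g (i.+1%:R / T%:R) - primitive g (j%:R / T%:R)| <= e / 2 * (j%:R / T%:R).
  elim: j => [|j IH] jk.
    by rewrite big_ord0 mulr0 mul0r primitive0 subrr normr0 mulr0.
  have jT : j.+1%:R / T%:R <= 1 :> R.
    by rewrite (le_trans _ s1)// (le_trans _ ks)// ler_pM2r ?invr_gt0// ler_nat.
  have j0 : 0 <= j%:R / T%:R :> R by rewrite divr_ge0.
  have jj : j%:R / T%:R <= j.+1%:R / T%:R :> R by rewrite ler_pM2r ?invr_gt0// ler_nat.
  have dj : j.+1%:R / T%:R - j%:R / T%:R = T%:R^-1 :> R.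
    by rewrite -mulrBl -natr1 addrC addKr mul1r.
  have := @primitive_increment g _ _ (g (j.+1%:R / T%:R)) (e / 2) cg j0 jj jT.
  rewrite dj => inc.
  have {inc} : `|primitive g (j.+1%:R / T%:R) - primitive g (j%:R / T%:R) -
      g (j.+1%:R / T%:R) * T%:R^-1| <= e / 2 * T%:R^-1.
    apply: inc; move=> u /andP[ju uj]; rewrite ltW//; apply: Hd.
    + by rewrite (le_trans j0 ju) (le_trans uj jT).
    + by rewrite (le_trans j0 jj) jT.
    + apply: le_lt_trans Td; rewrite mul1r distrC ger0_norm ?subr_ge0// -dj; lra.
  rewrite ler_norml => /andP[i1 i2].
  have := IH (ltnW jk); rewrite ler_norml => /andP[h1 h2].
  have hj : e / 2 * (j.+1%:R / T%:R) = e / 2 * (j%:R / T%:R) + e / 2 * T%:R^-1.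
    by rewrite -mulrDr -[X in _ = _ * (_ + X)]dj addrC subrK.
  rewrite big_ord_recr/= mulrDr ler_norml hj.
  rewrite [_^-1 * g _]mulrC.
  by apply/andP; split; lra.
have := H k (leqnn k).
have := @primitive_lipschitz g _ s M cg HM _ ks s1.
rewrite divr_ge0// => /(_ isT).
rewrite !ler_norml => /andP[a1 a2] /andP[b1 b2].
have : M * (s - k%:R / T%:R) <= M / T%:R.
  rewrite ler_wpM2l// lerBlDr -[X in X + _]mul1r -mulrDl ler_pdivlMr// mulrC.
  by rewrite nat1r ltW.
have : e / 2 * (k%:R / T%:R) <= e / 2.
  by rewrite ger_pMr// (le_trans ks).
by move=> *; apply/andP; split; lra.
Qed.

End riemann.

(** * The Hilbert matrix *)

Section hilbert.
Context {R : realType}.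

(** If [v] is in the kernel, the rational function [\sum_j v_j / (x + j + 1)]
    vanishes at [0, ..., p].  Its numerator [N] has degree at most [p], hence is
    zero, and evaluating it at the pole [- (j + 1)] isolates [v_j]. *)
Lemma hilbert_matrix_unit p : hilbert_matrix p \in @unitmx R p.+1.
Proof.
rewrite -row_free_unit; apply: inj_row_free => v vH.
pose Q j : {poly R} := \prod_(l < p.+1 | l != j) ('X + (l.+1%:R)%:P).
pose N : {poly R} := \sum_(j < p.+1) v 0 j *: Q j.
have sQ j : size (Q j) = p.+1.
  rewrite /Q (eq_bigr (fun l : 'I_p.+1 => 'X - (- l.+1%:R)%:P)); last first.
    by move=> l _; rewrite polyCN opprK.
  by rewrite -big_filter size_prod_XsubC size_filter -sum1_count sum1_card cardC1 card_ord.
have QE j i : (Q j).[i%:R] = (\prod_(l < p.+1) (i + l.+1)%:R) * ((i + j).+1%:R)^-1.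
  rewrite [X in _ = X * _](bigD1 j)//= /Q horner_prod addnS mulrC mulKf ?pnatr_eq0//.
  by apply: eq_bigr => l _; rewrite !hornerE natrD.
have N0 : N = 0.
  apply: (@roots_geq_poly_eq0 _ _ [seq i%:R | i <- iota 0 p.+1]).
  - apply/allP => x /mapP[i]; rewrite mem_iota add0n /= => ip ->.
    apply/rootP; rewrite /N horner_sum.
    under eq_bigr do rewrite hornerZ QE mulrCA.
    rewrite -mulr_sumr; apply/eqP; rewrite mulf_eq0; apply/orP; right; apply/eqP.
    have /matrixP/(_ 0 (Ordinal ip)) := vH; rewrite !mxE => vi.
    rewrite -[RHS]vi; apply: eq_bigr => j _.
    by rewrite !mxE/= addnC.
  - by rewrite map_inj_uniq ?iota_uniq//; exact: mulrIn (oner_neq0 _).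
  - rewrite size_map size_iota (leq_trans (size_sum _ _ _))//.
    by apply/bigmax_leqP => j _; rewrite (leq_trans (size_scale_leq _ _))// sQ.
apply/rowP => j; rewrite mxE.
have : N.[- j.+1%:R] = 0 by rewrite N0 horner0.
rewrite /N horner_sum (bigD1 j)//= big1 ?addr0; last first.
  move=> l lj; rewrite hornerZ /Q horner_prod (bigD1 j) 1?eq_sym//=.
  by rewrite hornerD hornerX hornerC addNr mul0r mulr0.
move=> /eqP; rewrite hornerZ mulf_eq0 => /predU1P[//|].
rewrite /Q horner_prod prodf_seq_eq0 => /hasP[l _ /andP[lj]].
rewrite !hornerE addrC subr_eq0 eqr_nat eqSS => /eqP lj'.
by move: lj; rewrite (ord_inj lj') eqxx.
Qed.

Lemma primitive_exp n : primitive (fun u : R => u ^+ n) 1 = n.+1%:R^-1.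
Proof.
rewrite /primitive /Rintegral.
rewrite (@continuous_FTC2 R (fun u => u ^+ n) (fun u => n.+1%:R^-1 * u ^+ n.+1) 0 1).
- by rewrite /= expr1n expr0n/= mulr1 mulr0 subr0.
- exact: ltr01.
- by apply: continuous_subspaceT => u; exact: exprn_continuous.
- split.
  + by move=> x _; apply: derivableM => //; exact: exprn_derivable.
  + apply: cvgM; first exact: cvg_cst.
    apply: cvg_at_right_filter; exact: exprn_continuous.
  + apply: cvgM; first exact: cvg_cst.
    apply: cvg_at_left_filter; exact: exprn_continuous.
- move=> x _; rewrite derive1E.
  have -> : (fun u : R => n.+1%:R^-1 * u ^+ n.+1) = n.+1%:R^-1 \*: (fun u : R => u ^+ n.+1) by [].
  rewrite deriveZ; last exact: exprn_derivable.
  by rewrite -derive1E exp_derive1/= scalerA mulVf ?pnatr_eq0// scale1r.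
Qed.

End hilbert.

(** * Least squares residuals on the rescaled time scale *)

Section matrix_limits.
Context {R : realType}.

Lemma cvg_det n (A_ : nat -> 'M[R]_n) (A : 'M[R]_n) :
  (forall i j, A_ t i j @[t --> \oo] --> A i j) ->
  \det (A_ t) @[t --> \oo] --> \det A.
Proof.
move=> AA; rewrite /determinant.
apply: (@cvg_big _ _ +%R) => [|s _]; first exact: add_continuous.
apply: cvgM; first exact: cvg_cst.
elim: (index_enum _) => [|i r IH].
  by rewrite big_nil; under eq_cvg do rewrite big_nil; exact: cvg_cst.
by rewrite big_cons; under eq_cvg do rewrite big_cons; exact: cvgM.
Qed.

(** Determinants and cofactors are polynomials in the entries, and by Cramer's
    rule so is the inverse, up to the division by a determinant that is
    eventually nonzero. *)
Lemma cvg_invmx n (A_ : nat -> 'M[R]_n) (A : 'M[R]_n) : A \in unitmx ->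
  (forall i j, A_ t i j @[t --> \oo] --> A i j) ->
  (\forall t \near \oo, A_ t \in unitmx) /\
  forall i j, invmx (A_ t) i j @[t --> \oo] --> invmx A i j.
Proof.
move=> uA AA; have dA := cvg_det AA.
have dA0 : \det A != 0 by rewrite -unitfE -unitmxE.
have uA_ : \forall t \near \oo, A_ t \in unitmx.
  near=> t; rewrite unitmxE unitfE; near: t.
  exact: (@cvgr_neq0 R R^o _ _ _ _ _ dA dA0).
split => // i j.
rewrite {2}/invmx uA !mxE.
suff : (\det (A_ t))^-1 * cofactor (A_ t) j i @[t --> \oo] --> (\det A)^-1 * cofactor A j i.
  apply: cvg_trans; apply: near_eq_cvg; near=> t.
  have uAt : A_ t \in unitmx by near: t.
  by rewrite /invmx uAt !mxE.
apply: cvgM; first exact: cvgV.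
apply: cvgM; first exact: cvg_cst.
by apply: cvg_det => a b; rewrite !mxE; under eq_cvg do rewrite !mxE; exact: AA.
Unshelve. all: by end_near. Qed.

End matrix_limits.

(** Dividing the regressors by powers of [t] is a change of basis of the regression
    space, by [diag_pow t]; it does not change the residuals, but makes the
    Gram matrix converge. *)
Section least_squares.
Context {R : realType}.
Variable p : nat.
Implicit Types (Y Z : nat -> R) (k t : nat).

Definition scaled_design t : 'M[R]_(t, p.+1) :=
  \matrix_(i < t, j < p.+1) (i.+1%:R / t%:R) ^+ j.

Definition scaled_gram t : 'M[R]_p.+1 :=
  t%:R^-1 *: ((scaled_design t)^T *m scaled_design t).

Lemma scaled_gramE t a b :
  scaled_gram t a b = t%:R^-1 * \sum_(i < t) (i.+1%:R / t%:R) ^+ (a + b).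
Proof.
rewrite !mxE; congr (_ * _); apply: eq_bigr => i _.
by rewrite !mxE exprD.
Qed.

Lemma cvg_scaled_gram :
  (\forall t \near \oo, scaled_gram t \in unitmx) /\
  forall a b, invmx (scaled_gram t) a b @[t --> \oo] --> invmx (@hilbert_matrix R p) a b.
Proof.
apply: cvg_invmx; first exact: hilbert_matrix_unit.
move=> a b; rewrite mxE -primitive_exp.
under eq_cvg do rewrite scaled_gramE.
apply/(@cvgrPdist_le _ R^o) => e e0.
have cf : {within `[0, 1], continuous (fun u : R => u ^+ (a + b))}.
  by apply: continuous_subspaceT => u; exact: exprn_continuous.
have [N HN] := riemann_sum cf e0.
exists N => // t /= Nt; have := HN t Nt 1.
by rewrite mulr1 natrK ler01 lexx distrC; exact.
Qed.

Definition diag_pow t : 'M[R]_p.+1 := diag_mx (\row_j t%:R ^+ j).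

Lemma diag_pow_unit t : (0 < t)%N -> diag_pow t \in unitmx.
Proof.
move=> t0; rewrite unitmxE unitfE det_diag; apply/prodf_neq0 => j _.
by rewrite mxE expf_neq0// pnatr_eq0 -lt0n.
Qed.

Lemma regressorE k t : (0 < t)%N ->
  regressor p k = diag_pow t *m vvec p k%:R t%:R :> 'cV[R]_p.+1.
Proof.
move=> t0; apply/colP => j; rewrite mul_diag_mx !mxE.
by rewrite -exprMn mulrC divfK// pnatr_eq0 -lt0n.
Qed.

Lemma designE t : (0 < t)%N -> design p t = scaled_design t *m diag_pow t.
Proof.
move=> t0; apply/matrixP => i j; rewrite mul_mx_diag !mxE.
by rewrite -exprMn divfK// pnatr_eq0 -lt0n.
Qed.

Lemma invmx_eq n (A B : 'M[R]_n) : A *m B = 1%:M -> invmx A = B.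
Proof.
by move=> AB; have [uA _] := mulmx1_unit AB; rewrite -[LHS]mulmx1 -AB mulKmx.
Qed.

Lemma mulmx_invmx_diag t (A : 'M[R]_p.+1) : (0 < t)%N -> A \in unitmx ->
  invmx (diag_pow t *m A *m diag_pow t) =
  invmx (diag_pow t) *m invmx A *m invmx (diag_pow t).
Proof.
move=> t0 uA; have uD := diag_pow_unit t0; apply: invmx_eq.
by rewrite !mulmxA mulmxK// mulmxK// mulmxV.
Qed.

Lemma gramE t : (0 < t)%N -> (design p t)^T *m design p t =
  diag_pow t *m (t%:R *: scaled_gram t) *m diag_pow t :> 'M[R]_p.+1.
Proof.
move=> t0; rewrite /scaled_gram scalerA divff ?pnatr_eq0 -?lt0n// scale1r.
by rewrite designE// trmx_mul tr_diag_mx !mulmxA.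
Qed.

Lemma gram_unit t : (0 < t)%N -> scaled_gram t \in unitmx ->
  (design p t)^T *m design p t \in @unitmx R p.+1.
Proof.
move=> t0 uG; rewrite gramE// !unitmx_mul diag_pow_unit// unitmxZ ?uG//.
by rewrite unitfE pnatr_eq0 -lt0n.
Qed.

(** The diagonal matrices of the change of basis cancel between the regressor, the
    inverse of the Gram matrix and the design. *)
Lemma residual_scaled Y k t : (0 < t)%N -> scaled_gram t \in unitmx ->
  residual p Y k t = Y k - \sum_(a < p.+1) \sum_(b < p.+1) (k%:R / t%:R) ^+ a *
    invmx (scaled_gram t) a b *
    (t%:R^-1 * \sum_(i < t) (i.+1%:R / t%:R) ^+ b * Y i.+1).
Proof.
move=> t0 uG; have tn0 : t%:R != 0 :> R by rewrite pnatr_eq0 -lt0n.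
have uD := diag_pow_unit t0.
rewrite /residual gramE// mulmx_invmx_diag//; last first.
  by rewrite unitmxZ// unitfE.
rewrite invmxZ; last by rewrite unitmxZ// unitfE.
rewrite (regressorE k t0) (designE t0) !trmx_mul !mulmxA tr_diag_mx -/(diag_pow t).
rewrite mulmxK// mulmxKV//; congr (_ - _).
rewrite -scalemxAr -!scalemxAl -!mulmxA mxE [X in _ * X = _]mxE mulr_sumr.
apply: eq_bigr => a _.
rewrite [X in _ * (_ * X) = _]mxE !mulr_sumr; apply: eq_bigr => b _.
rewrite [X in _ * (_ * (_ * X)) = _]mxE.
rewrite (eq_bigr (fun i : 'I_t => (i.+1%:R / t%:R) ^+ b * Y i.+1)).
  by rewrite [(vvec p _ _)^T 0 a]mxE [vvec p _ _ a 0]mxE; ring.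
by move=> i _; rewrite !mxE.
Qed.

(** A polynomial of degree at most [p] is reproduced by its own regression. *)
Lemma residual_trend (b : 'I_p.+1 -> R) Y Z k t : (0 < t)%N -> scaled_gram t \in unitmx ->
  (0 < k)%N -> (forall i, (0 < i)%N -> Y i = \sum_(j < p.+1) b j * i%:R ^+ j + Z i) ->
  residual p Y k t = residual p Z k t.
Proof.
move=> t0 uG k0 YZ; rewrite /residual.
have -> : \col_(i < t) Y i.+1 = design p t *m (\col_j b j) + \col_(i < t) Z i.+1.
  apply/colP => i; rewrite !mxE YZ//; congr (_ + _).
  by apply: eq_bigr => j _; rewrite !mxE mulrC.
rewrite mulmxDr mxE YZ//.
have -> : (regressor p k)^T *m invmx ((design p t)^T *m design p t) *m (design p t)^T *m
    (design p t *m (\col_j b j)) = (regressor p k)^T *m (\col_j b j).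
  by rewrite -!mulmxA (mulmxA (design p t)^T) mulKmx// gram_unit.
rewrite [X in _ - (X + _)]mxE opprD addrACA.
rewrite (eq_bigr (fun j : 'I_p.+1 => (regressor p k)^T 0 j * (\col_j b j) j 0)).
  by rewrite subrr add0r.
by move=> j _; rewrite !mxE mulrC.
Qed.

End least_squares.

(** * Uniform convergence on a set *)

Section uniform_limits.
Context {R : realType} {X : Type}.
Variable A : set X.
Implicit Types (f g : nat -> X -> R) (l m : X -> R).

Definition uniform_cvg f l := forall e : R, 0 < e ->
  exists N, forall n, (N <= n)%N -> forall x, A x -> `|f n x - l x| <= e.

Definition bounded_on l := exists M : R, forall x, A x -> `|l x| <= M.

Lemma uniform_cvg_cst l : uniform_cvg (fun=> l) l.
Proof. by move=> e e0; exists 0%N => n _ x _; rewrite subrr normr0 ltW. Qed.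

Lemma uniform_cvg_eq f g l : (exists N, forall n, (N <= n)%N -> forall x, A x -> f n x = g n x) ->
  uniform_cvg f l -> uniform_cvg g l.
Proof.
move=> [N1 fg] fl e e0; have [N2 H] := fl e e0.
exists (maxn N1 N2) => n; rewrite geq_max => /andP[n1 n2] x Ax.
by rewrite -fg//; exact: H.
Qed.

Lemma uniform_cvgD f g l m : uniform_cvg f l -> uniform_cvg g m ->
  uniform_cvg (fun n x => f n x + g n x) (fun x => l x + m x).
Proof.
move=> fl gm e e0; have e20 : 0 < e / 2 by rewrite divr_gt0.
have [N1 H1] := fl _ e20; have [N2 H2] := gm _ e20.
exists (maxn N1 N2) => n; rewrite geq_max => /andP[n1 n2] x Ax.
rewrite opprD addrACA (le_trans (ler_normD _ _))// (splitr e).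
by rewrite lerD ?H1 ?H2.
Qed.

Lemma uniform_cvg_sum (I : Type) (r : seq I) (f : I -> nat -> X -> R) (l : I -> X -> R) :
  (forall i, uniform_cvg (f i) (l i)) ->
  uniform_cvg (fun n x => \sum_(i <- r) f i n x) (fun x => \sum_(i <- r) l i x).
Proof.
move=> fl; elim: r => [|i r IH].
  apply: uniform_cvg_eq (uniform_cvg_cst _).
  by exists 0%N => n _ x _; rewrite !big_nil.
have := uniform_cvgD (fl i) IH.
by congr uniform_cvg; apply/funext => n; rewrite ?big_cons//; apply/funext => x; rewrite big_cons.
Qed.

Lemma uniform_cvgM f g l m : bounded_on l -> bounded_on m ->
  uniform_cvg f l -> uniform_cvg g m ->
  uniform_cvg (fun n x => f n x * g n x) (fun x => l x * m x).
Proof.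
move=> [L HL] [M HM] fl gm e e0.
(* [K] bounds [l] and, as [d <= 1], also [g n] for late [n]. *)
pose K := 1 + `|L| + `|M|.
have K1 : 1 <= K by rewrite /K -addrA lerDl addr_ge0.
have K0 : 0 < K by apply: lt_le_trans K1.
pose d := Num.min 1 (e / (2 * K)).
have d0 : 0 < d by rewrite lt_min ltr01 divr_gt0// mulr_gt0.
have [N1 H1] := fl _ d0; have [N2 H2] := gm _ d0.
exists (maxn N1 N2) => n; rewrite geq_max => /andP[n1 n2] x Ax.
have h1 := H1 n n1 x Ax; have h2 := H2 n n2 x Ax.
have dK : d * K <= e / 2.
  have : d <= e / (2 * K) by rewrite /d ge_min lexx orbT.
  by rewrite ler_pdivlMr ?mulr_gt0// mulrCA; lra.
have d1 : d <= 1 by rewrite /d ge_min lexx.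
have lK : `|l x| <= K.
  by rewrite (le_trans (HL x Ax))// (le_trans (ler_norm _))// /K -addrA addrCA lerDl addr_ge0.
have gK : `|g n x| <= K.
  rewrite -[g n x](subrK (m x)) (le_trans (ler_normD _ _))//.
  have := HM x Ax; have := ler_norm M; rewrite /K; have := normr_ge0 L; lra.
rewrite (_ : _ - _ = (f n x - l x) * g n x + l x * (g n x - m x)); last by ring.
rewrite (le_trans (ler_normD _ _))// !normrM.
have a1 : `|f n x - l x| * `|g n x| <= d * K by apply: ler_pM.
have a2 : `|l x| * `|g n x - m x| <= K * d by apply: ler_pM.
by rewrite [K * d]mulrC in a2; lra.
Qed.

Lemma uniform_cvgX f l k : bounded_on l -> uniform_cvg f l ->
  uniform_cvg (fun n x => f n x ^+ k) (fun x => l x ^+ k).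
Proof.
move=> bl fl; elim: k => [|k IH]; first exact: uniform_cvg_cst.
have bk : bounded_on (fun x => l x ^+ k).
  have [M HM] := bl; exists (M ^+ k) => x Ax.
  by rewrite normrX lerXn2r ?nnegrE// ?HM// (le_trans _ (HM x Ax)).
have := uniform_cvgM bl bk fl IH.
by congr uniform_cvg; apply/funext => n; rewrite ?exprS//; apply/funext => x; rewrite exprS.
Qed.

Lemma uniform_cvgV f l (c : R) : 0 < c -> (forall x, A x -> c <= l x) -> uniform_cvg f l ->
  uniform_cvg (fun n x => (f n x)^-1) (fun x => (l x)^-1).
Proof.
move=> c0 cl fl e e0.
pose d := Num.min (c / 2) (e * c / 2 * c).
have d0 : 0 < d by rewrite lt_min !(mulr_gt0, divr_gt0).
have [N H] := fl _ d0; exists N => n nN x Ax.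
have lx := cl x Ax; have lx0 : 0 < l x by apply: lt_le_trans lx.
have dc : d <= c / 2 by rewrite /d ge_min lexx.
have de : d <= e * c / 2 * c by rewrite /d ge_min lexx orbT.
have := H n nN x Ax; rewrite ler_norml => /andP[h1 h2].
have fx : c / 2 <= f n x by lra.
have fx0 : 0 < f n x by apply: lt_le_trans fx; rewrite divr_gt0.
have -> : (f n x)^-1 - (l x)^-1 = (l x - f n x) / (f n x * l x).
  by field; rewrite !gt_eqF.
rewrite normrM normfV (gtr0_norm (mulr_gt0 fx0 lx0)) ler_pdivrMr ?mulr_gt0//.
rewrite distrC (le_trans (H n nN x Ax))// (le_trans de)//.
rewrite (_ : e * c / 2 * c = e * (c / 2 * c)); last by ring.
apply: ler_wpM2l; first exact: ltW.
by apply: ler_pM => //; rewrite ltW// divr_gt0.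
Qed.

End uniform_limits.

Lemma bounded_on_cst {R : realType} {X : Type} (A : set X) (c : R) : bounded_on A (fun=> c).
Proof. by exists `|c|. Qed.

Lemma bounded_onM {R : realType} {X : Type} (A : set X) (l m : X -> R) :
  bounded_on A l -> bounded_on A m -> bounded_on A (fun x => l x * m x).
Proof.
move=> [L HL] [M HM]; exists (L * M) => x Ax.
by rewrite normrM; apply: ler_pM => //; [exact: HL|exact: HM].
Qed.

Lemma bounded_onX {R : realType} {X : Type} (A : set X) (l : X -> R) k :
  bounded_on A l -> bounded_on A (fun x => l x ^+ k).
Proof.
move=> bl; elim: k => [|k IH]; first exact: bounded_on_cst.
have [M HM] := bounded_onM bl IH; exists M => x Ax.
by rewrite exprS; exact: HM.
Qed.

Section grid.
Context {R : realType}.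
Implicit Types (T : nat).

Lemma grid_le1 T (x : R) : 0 <= x -> x <= 1 -> (Num.truncn (T%:R * x) <= T)%N.
Proof.
move=> x0 x1; have /andP[Tx _] := truncn_itv (mulr_ge0 (ler0n R T) x0).
by rewrite -(ler_nat R) (le_trans Tx)// ler_piMr.
Qed.

Lemma grid_in01 T k : (k <= T)%N -> 0 <= (k%:R / T%:R : R) <= 1.
Proof.
move=> kT; rewrite divr_ge0//=.
have [->|T0] := posnP T; first by rewrite invr0 mulr0 ler01.
by rewrite ler_pdivrMr ?ltr0n// mul1r ler_nat.
Qed.

Lemma grid_dist T (x : R) : (0 < T)%N -> 0 <= x ->
  `|(Num.truncn (T%:R * x))%:R / T%:R - x| <= T%:R^-1.
Proof.
move=> T0 x0; have T0' : 0 < T%:R :> R by rewrite ltr0n.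
have /andP[h1 h2] := truncn_itv (mulr_ge0 (ltW T0') x0).
have k1 : (Num.truncn (T%:R * x))%:R / T%:R <= x.
  by rewrite ler_pdivrMr// [x * _]mulrC.
rewrite distrC ger0_norm ?subr_ge0// lerBlDr -[X in X + _]mul1r -mulrDl nat1r.
by rewrite ler_pdivlMr// [x * _]mulrC ltW.
Qed.

Lemma inv_nat_le (e : R) : 0 < e -> exists N, forall T, (N <= T)%N -> (0 < T)%N /\ T%:R^-1 <= e.
Proof.
move=> e0; exists (Num.truncn e^-1).+1 => T NT.
have T0 : (0 < T)%N by apply: leq_trans NT.
split => //; rewrite -[e]invrK lef_pV2 ?posrE ?ltr0n ?invr_gt0//.
by apply/ltW/(lt_le_trans (truncnS_gt _)); rewrite ler_nat.
Qed.

Context {X : Type}.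
Variables (A : set X) (c : X -> R).

Lemma uniform_cvg_grid : (forall x, A x -> 0 <= c x) ->
  uniform_cvg A (fun T x => (Num.truncn (T%:R * c x))%:R / T%:R) c.
Proof.
move=> c0 e /inv_nat_le[N HN]; exists N => T /HN[T0 Te] x Ax.
exact: le_trans (grid_dist T0 (c0 _ Ax)) Te.
Qed.

Lemma uniform_cvg_comp (g : R -> R) : (forall x, A x -> 0 <= c x <= 1) ->
  {within `[0, 1], continuous g} ->
  uniform_cvg A (fun T x => g ((Num.truncn (T%:R * c x))%:R / T%:R)) (fun x => g (c x)).
Proof.
move=> c01 cg e e0; have [d d0 Hd] := within_continuous_unif cg e0.
have d20 : 0 < d / 2 by rewrite divr_gt0.
have [||N HN] := @uniform_cvg_grid _ (d / 2) => //.
  by move=> x /c01/andP[].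
exists N => T NT x Ax; apply/ltW/Hd; last by apply: le_lt_trans (HN T NT x Ax) _; lra.
  by have /andP[x0 x1] := c01 x Ax; apply: grid_in01; exact: grid_le1.
exact: c01.
Qed.

Lemma uniform_cvg_index (a : nat -> R) l (kappa : R) : 0 < kappa ->
  (forall x, A x -> kappa <= c x) -> a t @[t --> \oo] --> l ->
  uniform_cvg A (fun T x => a (Num.truncn (T%:R * c x))) (fun=> l).
Proof.
move=> k0 ck /(@cvgrPdist_le _ R^o) al e e0; have [N _ HN] := al e e0.
exists (Num.truncn (N%:R / kappa)).+1 => T NT x Ax.
rewrite distrC; apply: HN => /=.
have T0 : 0 <= T%:R :> R by [].
rewrite truncn_ge_nat; last first.
  by rewrite mulr_ge0// (le_trans (ltW k0))// ck.
apply: (@le_trans _ _ (T%:R * kappa)); last by rewrite ler_wpM2l// ck.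
rewrite -ler_pdivrMr//; apply/ltW/(lt_le_trans (truncnS_gt _)).
by rewrite ler_nat.
Qed.

End grid.

(** * The residual operators and their uniform convergence *)

Section residual_operators.
Context {R : realType}.
Variables (p : nat) (kappa : R).
Hypothesis kappa_gt0 : 0 < kappa.
Implicit Types (f g : R -> R).
Notation mu := (@lebesgue_measure R).

Let triangle : set (R * R) := [set x | kappa <= x.1 /\ x.1 <= x.2 /\ x.2 <= 1].
Let iH := invmx (@hilbert_matrix R p).

Definition moment f (b : nat) (s : R) : R := primitive (fun u => u ^+ b * f u) s.

(** With [x = (r, s)] this is [f r] minus the value at [r] of the best polynomial
    approximation of [f] of degree at most [p] in [L^2] of [[0, s]]: the moments
    of [f] on [[0, s]] are brought back to [[0, 1]] by powers of [s^-1]. *)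
Definition projection_residual f (x : R * R) : R :=
  f x.1 - \sum_(a < p.+1) \sum_(b < p.+1)
    (x.1 / x.2) ^+ a * iH a b * (x.2^-1 ^+ b.+1 * moment f b x.2).

(** The least squares residual of the values of [f] at the points [i / T]; compare
    [residual_scaled]. *)
Definition sampled_residual (T : nat) f (x : R * R) : R :=
  let k := Num.truncn (T%:R * x.1) in let t := Num.truncn (T%:R * x.2) in
  f (k%:R / T%:R) - \sum_(a < p.+1) \sum_(b < p.+1)
    (k%:R / t%:R) ^+ a * invmx (scaled_gram p t) a b *
    (t%:R^-1 * \sum_(i < t) (i.+1%:R / t%:R) ^+ b * f (i.+1%:R / T%:R)).

Lemma continuous_moment_integrand f b : {within `[0, 1], continuous f} ->
  {within `[0, 1], continuous (fun u => u ^+ b * f u)}.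
Proof.
move=> cf.
have cX : {within `[0, 1], continuous (fun u : R => u ^+ b)}.
  by apply: continuous_subspaceT => v; exact: exprn_continuous.
by move=> u; apply: cvgM; [exact: cX|exact: cf].
Qed.

Let tri x : triangle x -> [/\ 0 < x.1, 0 < x.2, x.1 <= 1 & 0 <= x.1 <= 1 /\ 0 <= x.2 <= 1].
Proof.
move=> [kx [x12 x21]]; have x10 : 0 < x.1 by apply: lt_le_trans kx.
have x20 : 0 < x.2 by apply: lt_le_trans x12.
have x11 : x.1 <= 1 by apply: le_trans x21.
by split => //; rewrite x11 x21 !ltW.
Qed.

(** The normalisation by [t] is traded for the normalisation by [T], so that
    the sum becomes a Riemann sum of the fixed integrand [u ^ b * g u], whose upper
    limit only depends on [t]; [riemann_sum] is uniform in that limit. *)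
Lemma sampled_momentE T g b t : (0 < T)%N ->
  t%:R^-1 * \sum_(i < t) (i.+1%:R / t%:R) ^+ b * g (i.+1%:R / T%:R) =
  (t%:R / T%:R)^-1 ^+ b.+1 *
  (T%:R^-1 * \sum_(i < t) ((i.+1%:R / T%:R) ^+ b * g (i.+1%:R / T%:R))) :> R.
Proof.
move=> T0; have Tn0 : T%:R != 0 :> R by rewrite pnatr_eq0 -lt0n.
have E : t%:R^-1 = (t%:R / T%:R)^-1 * T%:R^-1 :> R by rewrite invf_div mulrAC divff// mul1r.
rewrite E exprS -!mulrA; congr (_ * _); rewrite mulrCA; congr (_ * _).
rewrite mulr_sumr; apply: eq_bigr => i _; rewrite [RHS]mulrA -exprMn.
congr (_ ^+ _ * _); rewrite invf_div [RHS]mulrC.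
by ring.
Qed.

Lemma sampled_residual_cvg g : {within `[0, 1], continuous g} ->
  uniform_cvg triangle (fun T => sampled_residual T g) (projection_residual g).
Proof.
move=> cg.
have b1 : bounded_on triangle fst.
  by exists 1 => x /tri[x10 _ x11 _]; rewrite gtr0_norm.
have b2 : bounded_on triangle snd.
  by exists 1 => x [kx [x12 x21]]; rewrite gtr0_norm// (lt_le_trans kappa_gt0)// (le_trans kx).
have kx2 x : triangle x -> kappa <= x.2 by move=> [kx [x12 _]]; exact: le_trans kx x12.
have b2V : bounded_on triangle (fun x => x.2^-1).
  exists kappa^-1 => x Ax; have [_ x20 _ _] := tri Ax.
  by rewrite gtr0_norm ?invr_gt0// lef_pV2 ?posrE// kx2.
have u1 : uniform_cvg triangle (fun T x => (Num.truncn (T%:R * x.1))%:R / T%:R) fst.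
  by apply: uniform_cvg_grid => x /tri[_ _ _ [/andP[]]].
have u2 : uniform_cvg triangle (fun T x => (Num.truncn (T%:R * x.2))%:R / T%:R) snd.
  by apply: uniform_cvg_grid => x /tri[_ _ _ [_ /andP[]]].
have u2V := uniform_cvgV kappa_gt0 kx2 u2.
have ug : uniform_cvg triangle
    (fun T x => g ((Num.truncn (T%:R * x.1))%:R / T%:R)) (fun x => g x.1).
  by apply: uniform_cvg_comp => // x /tri[_ _ _ []].
have [_ cG] := @cvg_scaled_gram R p.
have uG a b : uniform_cvg triangle
    (fun T x => invmx (scaled_gram p (Num.truncn (T%:R * x.2))) a b) (fun=> iH a b).
  exact: (uniform_cvg_index kappa_gt0 kx2 (cG a b)).
have um b : uniform_cvg triangle
   (fun T x => T%:R^-1 * \sum_(i < Num.truncn (T%:R * x.2))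
      ((i.+1%:R / T%:R) ^+ b * g (i.+1%:R / T%:R)))
   (fun x => moment g b x.2).
  move=> e e0; have [N HN] := riemann_sum (continuous_moment_integrand (b := b) cg) e0.
  by exists N => T NT x /tri[_ _ _ [_ x2]]; exact: HN.
have bm b : bounded_on triangle (fun x => moment g b x.2).
  have cm := continuous_moment_integrand (b := b) cg.
  have [M HM] := within_continuous_bounded cm.
  have M0 : 0 <= M by apply: le_trans (normr_ge0 _) (HM 0 _); rewrite lexx ler01.
  exists M => x /tri[_ _ _ [_ /andP[x20 x21]]].
  have := primitive_lipschitz cm HM (lexx 0) x20 x21.
  rewrite primitive0 !subr0 => /le_trans; apply.
  by rewrite ler_piMr.
have bB b : bounded_on triangle (fun x => x.2^-1 ^+ b.+1 * moment g b x.2).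
  by apply: bounded_onM => //; exact: bounded_onX.
have bA (a b : 'I_p.+1) : bounded_on triangle (fun x => (x.1 / x.2) ^+ a * iH a b).
  apply: bounded_onM; last exact: bounded_on_cst.
  by apply: bounded_onX; exact: bounded_onM.
pose S (T : nat) (x : R * R) := \sum_(a < p.+1) \sum_(b < p.+1)
   ((Num.truncn (T%:R * x.1))%:R / T%:R * ((Num.truncn (T%:R * x.2))%:R / T%:R)^-1) ^+ a *
   invmx (scaled_gram p (Num.truncn (T%:R * x.2))) a b *
   (((Num.truncn (T%:R * x.2))%:R / T%:R)^-1 ^+ b.+1 *
   (T%:R^-1 * \sum_(i < Num.truncn (T%:R * x.2))
      ((i.+1%:R / T%:R) ^+ b * g (i.+1%:R / T%:R)))).
pose l (x : R * R) := \sum_(a < p.+1) \sum_(b < p.+1)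
    (x.1 / x.2) ^+ a * iH a b * (x.2^-1 ^+ b.+1 * moment g b x.2).
have uS : uniform_cvg triangle S l.
  apply: uniform_cvg_sum => a; apply: uniform_cvg_sum => b.
  apply: uniform_cvgM => //.
    apply: uniform_cvgM => //; [|exact: bounded_on_cst|].
      by apply: bounded_onX; exact: bounded_onM.
    apply: uniform_cvgX; first exact: bounded_onM.
    exact: uniform_cvgM.
  apply: uniform_cvgM => //; first exact: bounded_onX.
  exact: uniform_cvgX.
have uN := uniform_cvgM (bounded_on_cst triangle (-1)) _ (uniform_cvg_cst triangle (fun=> -1)) uS.
have bl : bounded_on triangle l.
  have [M HM] : exists M : 'I_p.+1 -> 'I_p.+1 -> R, forall (a b : 'I_p.+1) x, triangle x ->
     `|(x.1 / x.2) ^+ a * iH a b * (x.2^-1 ^+ b.+1 * moment g b x.2)| <= M a b.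
    have bAB a b := bounded_onM (bA a b) (bB b).
    exists (fun a b => sval (cid (bAB a b))) => a b x; exact: (svalP (cid (bAB a b))).
  exists (\sum_(a < p.+1) \sum_(b < p.+1) M a b) => x Ax.
  apply: le_trans (ler_norm_sum _ _ _) _; apply: ler_sum => a _.
  apply: le_trans (ler_norm_sum _ _ _) _; apply: ler_sum => b _.
  exact: HM.
have := uniform_cvgD ug (uN bl).
rewrite (_ : (fun x => g x.1 + -1 * l x) = projection_residual g); last first.
  by apply/funext => x; rewrite mulN1r.
apply: uniform_cvg_eq.
exists 1%N => T T0 x Ax; rewrite mulN1r /sampled_residual; congr (_ - _).
have Tn0 : T%:R != 0 :> R by rewrite pnatr_eq0 -lt0n.
apply: eq_bigr => a _; apply: eq_bigr => b _; congr (_ ^+ _ * _ * _).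
  by rewrite invf_div mulrA divfK.
by rewrite sampled_momentE.
Qed.

Definition residual_bound : R :=
  1 + \sum_(a < p.+1) \sum_(b < p.+1) (`|iH a b| + 1).

Lemma residual_bound_ge0 : 0 <= residual_bound.
Proof.
by rewrite addr_ge0// sumr_ge0// => a _; rewrite sumr_ge0.
Qed.

(** On the triangle the points [k / t] and [i.+1 / t] stay in [[0, 1]], and the
    entries of the inverse Gram matrix are eventually within 1 of those of the
    inverse Hilbert matrix. *)
Lemma sampled_residual_le : exists N, forall T, (N <= T)%N -> forall f (c : R),
  (forall u, 0 <= u <= 1 -> `|f u| <= c) ->
  forall x, triangle x -> `|sampled_residual T f x| <= residual_bound * c.
Proof.
have [_ cG] := @cvg_scaled_gram R p.
have kx2 x : triangle x -> kappa <= x.2 by move=> [kx [x12 _]]; exact: le_trans kx x12.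
have uG : forall ab : 'I_p.+1 * 'I_p.+1, exists N, forall T, (N <= T)%N -> forall x, triangle x ->
    `|invmx (scaled_gram p (Num.truncn (T%:R * x.2))) ab.1 ab.2 - iH ab.1 ab.2| <= 1.
  move=> [a b]; exact: (uniform_cvg_index kappa_gt0 kx2 (cG a b) ltr01).
have [N HN] := choice uG.
exists (maxn 1 (\max_ab N ab)) => T; rewrite geq_max => /andP[T0 NT] f c fc x Ax.
have c0 : 0 <= c by apply: le_trans (normr_ge0 _) (fc 0 _); rewrite lexx ler01.
have [x10 x20 x11 [x1I x2I]] := tri Ax.
rewrite /sampled_residual /residual_bound.
set k := Num.truncn (_ * x.1); set t := Num.truncn (_ * x.2).
have kT : (k <= T)%N by apply: grid_le1; case/andP: x1I.
have tT : (t <= T)%N by apply: grid_le1; case/andP: x2I.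
have kt : (k <= t)%N by apply: le_truncn; rewrite ler_wpM2l//; case: Ax => _ [].
rewrite mulrDl mul1r; apply: le_trans (ler_normB _ _) _; apply: lerD.
  by apply: fc; exact: grid_in01.
rewrite mulr_suml; apply: le_trans (ler_norm_sum _ _ _) _; apply: ler_sum => a _.
rewrite mulr_suml; apply: le_trans (ler_norm_sum _ _ _) _; apply: ler_sum => b _.
rewrite !normrM -mulrA.
have h1 : `|(k%:R / t%:R) ^+ a| <= 1 :> R.
  have /andP[h0 h1] : 0 <= (k%:R / t%:R : R) <= 1 := grid_in01 kt.
  by rewrite ger0_norm ?exprn_ge0// exprn_ile1.
have h2 : `|invmx (scaled_gram p t) a b| <= `|iH a b| + 1.
  have NabT : (N (a, b) <= T)%N by apply: leq_trans NT; exact: leq_bigmax.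
  have := HN (a, b) T NabT x Ax; rewrite /= -/t => h.
  rewrite -[invmx _ a b](subrK (iH a b)) (le_trans (ler_normD _ _))//.
  by rewrite addrC lerD2l.
have h3 : `|t%:R^-1| * `|\sum_(i < t) (i.+1%:R / t%:R) ^+ b * f (i.+1%:R / T%:R)| <= c.
  have [t0|t0] := posnP t; first by rewrite t0 big_ord0 normr0 mulr0.
  rewrite ger0_norm ?invr_ge0// ler_pdivrMl ?ltr0n//.
  apply: le_trans (ler_norm_sum _ _ _) _.
  rewrite [leRHS](_ : _ = \sum_(i < t) c); last by rewrite sumr_const card_ord mulr_natl.
  apply: ler_sum => i _; rewrite normrM -[c]mul1r; apply: ler_pM => //.
    have /andP[h0 h4] : 0 <= (i.+1%:R / t%:R : R) <= 1 := grid_in01 (ltn_ord i).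
    by rewrite ger0_norm ?exprn_ge0// exprn_ile1.
  by apply: fc; apply: grid_in01; exact: leq_trans (ltn_ord i) tT.
apply: le_trans (_ : 1 * ((`|iH a b| + 1) * c) <= _).
  by apply: ler_pM => //; apply: ler_pM.
by rewrite mul1r.
Qed.

Lemma sampled_residualB T f g x :
  sampled_residual T f x - sampled_residual T g x = sampled_residual T (fun u => f u - g u) x.
Proof.
rewrite /sampled_residual.
set k := Num.truncn (_ * x.1); set t := Num.truncn (_ * x.2).
under [X in _ = _ - X]eq_bigr => a _.
  under eq_bigr => b _.
    under eq_bigr do rewrite mulrBr.
    rewrite sumrB mulrBr mulrBr; over.
  rewrite sumrB; over.
rewrite sumrB; ring.
Qed.

(** The limit inherits the bound on [sampled_residual]. *)
Lemma projection_residual_lipschitz f g (c : R) : {within `[0, 1], continuous f} ->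
  {within `[0, 1], continuous g} -> (forall u, 0 <= u <= 1 -> `|f u - g u| <= c) ->
  forall x, triangle x ->
  `|projection_residual f x - projection_residual g x| <= residual_bound * c.
Proof.
move=> cf cg fg x Ax.
have cfg : {within `[0, 1], continuous (fun u => f u - g u)}.
  by move=> u; apply: cvgB; [exact: cf|exact: cg].
have [N HN] := sampled_residual_le.
apply/ler_addgt0Pr => e e0.
have e20 : 0 < e / 2 by rewrite divr_gt0.
have [N1 H1] := sampled_residual_cvg cf e20; have [N2 H2] := sampled_residual_cvg cg e20.
pose T := maxn N (maxn N1 N2).
have NT : (N <= T)%N by rewrite leq_max leqnn.
have N1T : (N1 <= T)%N by rewrite !leq_max leqnn orbT.
have N2T : (N2 <= T)%N by rewrite !leq_max leqnn !orbT.
have := HN T NT _ c fg x Ax; rewrite -sampled_residualB.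
have := H1 T N1T x Ax; have := H2 T N2T x Ax.
rewrite !ler_norml => /andP[? ?] /andP[? ?] /andP[? ?].
by apply/andP; split; lra.
Qed.

(** The path [f] may vary with [T] and need not be continuous: linearity reduces the
    claim to the convergence for the fixed path [g]. *)
Lemma sampled_residual_approx g : {within `[0, 1], continuous g} -> forall e : R, 0 < e ->
  exists N, forall T, (N <= T)%N -> forall f, D1 0 1 f -> forall x, triangle x ->
    `|sampled_residual T f x - projection_residual g x| <=
      residual_bound * supdist 0 1 g f + e.
Proof.
move=> cg e e0; have [N1 H1] := sampled_residual_cvg cg e0.
have [N2 H2] := sampled_residual_le.
exists (maxn N1 N2) => T; rewrite geq_max => /andP[T1 T2] f Df x Ax.
have := H2 T T2 (fun u => f u - g u) (supdist 0 1 g f) _ x Ax.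
rewrite -sampled_residualB => h.
rewrite -(subrKA (sampled_residual T g x)) (le_trans (ler_normD _ _))//.
apply: lerD; last exact: H1.
by apply: h => u u01; exact: supdist_ge.
Qed.

End residual_operators.

(** * The space of paths indexed by a square *)

Section plane_paths.
Context {R : realType}.
Variables a b : R.
Implicit Types (f g : R * R -> R) (phi psi : R -> R).

Lemma D2_eq f g : (forall x, square a b x -> f x = g x) -> D2 a b f -> D2 a b g.
Proof.
move=> fg Df e e0; have [h Hh H] := Df e e0.
by exists h => // x sx; rewrite -fg//; exact: H.
Qed.

Lemma rectangle_span_add f g : rectangle_span a b f -> rectangle_span a b g ->
  rectangle_span a b (fun x => f x + g x).
Proof.
move=> [n [c [E [F [EF ->]]]]] [m [c' [E' [F' [EF' ->]]]]].
exists (n + m)%N.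
exists (fun i => match fintype.split i with inl j => c j | inr j => c' j end).
exists (fun i => match fintype.split i with inl j => E j | inr j => E' j end).
exists (fun i => match fintype.split i with inl j => F j | inr j => F' j end).
split; first by move=> i; case: fintype.split.
apply/funext => x; rewrite big_split_ord/=; congr (_ + _); apply: eq_bigr => i _.
  by rewrite (unsplitK (inl i)).
by rewrite (unsplitK (inr i)).
Qed.

Lemma rectangle_span_scale c f : rectangle_span a b f -> rectangle_span a b (fun x => c * f x).
Proof.
move=> [n [k [E [F [EF ->]]]]]; exists n, (fun i => c * k i), E, F; split => //.
by apply/funext => x; rewrite mulr_sumr; apply: eq_bigr => i _; rewrite mulrA.
Qed.

Lemma D2_add f g : D2 a b f -> D2 a b g -> D2 a b (fun x => f x + g x).
Proof.
move=> Df Dg e e0; have e20 : 0 < e / 2 by rewrite divr_gt0.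
have [f' sf Hf] := Df _ e20; have [g' sg Hg] := Dg _ e20.
exists (fun x => f' x + g' x); first exact: rectangle_span_add.
move=> x sx; rewrite opprD addrACA (le_trans (ler_normD _ _))// (splitr e).
by rewrite lerD ?Hf ?Hg.
Qed.

Lemma D2_scale c f : D2 a b f -> D2 a b (fun x => c * f x).
Proof.
move=> Df e e0; have c1 : 0 < `|c| + 1 by rewrite ltr_wpDl.
have [f' sf Hf] := Df _ (divr_gt0 e0 c1).
exists (fun x => c * f' x); first exact: rectangle_span_scale.
move=> x sx; rewrite -mulrBr normrM.
apply: le_trans (_ : (`|c| + 1) * (e / (`|c| + 1)) <= _).
  by apply: ler_pM => //; [rewrite lerDl|exact: Hf].
by rewrite mulrC divfK// gt_eqF.
Qed.

Lemma D2_rectangle E F : cell a b E -> cell a b F ->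
  D2 a b (fun x => \1_E x.1 * \1_F x.2).
Proof.
move=> cE cF e e0; exists (fun x => \1_E x.1 * \1_F x.2); last first.
  by move=> x _; rewrite subrr normr0 ltW.
exists 1%N, (fun=> 1), (fun=> E), (fun=> F); split => //.
apply/funext => -[r s]; rewrite big_ord_recl big_ord0 addr0 mul1r !indicE/=.
by rewrite in_setX/=; case: (r \in E); case: (s \in F); rewrite ?(mul0r, mulr0, mul1r).
Qed.

Lemma D2_0 : D2 a b (fun=> 0).
Proof.
have := @D2_rectangle [set b] [set b] (or_intror erefl) (or_intror erefl).
by move/(D2_scale 0); apply: D2_eq => x _; rewrite mul0r.
Qed.

Lemma D2_sum (I : Type) (r : seq I) (f : I -> R * R -> R) :
  (forall i, D2 a b (f i)) -> D2 a b (fun x => \sum_(i <- r) f i x).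
Proof.
move=> Df; elim: r => [|i r IH].
  by apply: D2_eq D2_0 => x _; rewrite big_nil.
by apply: D2_eq (D2_add (Df i) IH) => x _; rewrite big_cons.
Qed.

Lemma D2_uniform_limit f : (forall e : R, 0 < e -> exists2 g, D2 a b g &
  forall x, square a b x -> `|f x - g x| <= e) -> D2 a b f.
Proof.
move=> H e e0; have e20 : 0 < e / 2 by rewrite divr_gt0.
have [g Dg fg] := H _ e20; have [h sh gh] := Dg _ e20.
exists h => // x sx; rewrite -(subrKA (g x)) (le_trans (ler_normD _ _))// (splitr e).
by rewrite lerD ?fg ?gh.
Qed.

Hypothesis a0 : 0 <= a.
Hypothesis ab : a <= b.

(** At the right endpoint the cell of [b] is the singleton, which has to be added
    for the one index [i] that [b] belongs to. *)
Lemma floor_cells (N i : nat) r : (0 < N)%N -> a <= r <= b ->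
  (Num.truncn (N%:R * r) == i)%:R =
  \1_`[Num.max a (i%:R / N%:R), Num.min b (i.+1%:R / N%:R)[ r +
  (Num.truncn (N%:R * b) == i)%:R * \1_[set b] r :> R.
Proof.
move=> N0 /andP[ar rb]; have N0' : 0 < N%:R :> R by rewrite ltr0n.
rewrite !indicE; have [->|rb'] := eqVneq r b.
  rewrite [b \in [set b]]mem_set// mulr1 memNset ?add0r//=.
  by rewrite in_itv/= lt_min ltxx/= andbF.
rewrite [r \in [set b]]memNset ?mulr0 ?addr0; last by apply/eqP.
congr (nat_of_bool _)%:R; rewrite truncn_eq; last first.
  by rewrite mulr_ge0// (le_trans a0 ar).
rewrite mem_setE in_itv/= ge_max lt_min ar/= [r < b]lt_neqAle rb' rb/=.
by rewrite ler_pdivrMr// ltr_pdivlMr// ![_ * N%:R]mulrC.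
Qed.

Lemma cell_floor (N i : nat) :
  cell a b `[Num.max a (i%:R / N%:R), Num.min b (i.+1%:R / N%:R)[%classic.
Proof.
left; exists (Num.max a (i%:R / N%:R)), (Num.min b (i.+1%:R / N%:R)).
by split => //; rewrite ?le_max ?ge_min lexx.
Qed.

Lemma sum_delta (M k : nat) (F : nat -> R) : (k < M)%N ->
  \sum_(i < M) F i * (k == i)%:R = F k.
Proof.
move=> kM; rewrite (bigD1 (Ordinal kM))//= eqxx mulr1 big1 ?addr0// => i ik.
by rewrite [k == i](_ : _ = false) ?mulr0//; apply: contraNF ik => /eqP ik; apply/eqP/val_inj.
Qed.

(** Residual processes have this form.  So do the discretisations that approximate
    continuous functions in [D2_mul_continuous]. *)
Lemma D2_floor (N : nat) (h : nat -> nat -> R) : (0 < N)%N ->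
  D2 a b (fun x => h (Num.truncn (N%:R * x.1)) (Num.truncn (N%:R * x.2))).
Proof.
move=> N0; pose M := (Num.truncn (N%:R * b)).+1.
have ltM r : a <= r <= b -> (Num.truncn (N%:R * r) < M)%N.
  by move=> /andP[_ rb]; rewrite ltnS; apply: le_truncn; rewrite ler_wpM2l.
have := @D2_sum 'I_M (index_enum _) (fun i x => \sum_(j < M) h i j *
  ((Num.truncn (N%:R * x.1) == i)%:R * (Num.truncn (N%:R * x.2) == j)%:R)).
move=> /(_ _)/D2_eq; apply.
  move=> [r s] /= [/=]; rewrite !in_itv/= => rab sab.
  rewrite -[RHS](sum_delta (fun i => h i _) (ltM r rab)); apply: eq_bigr => i _.
  rewrite -(sum_delta (h i) (ltM s sab)) mulr_suml; apply: eq_bigr => j _.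
  by rewrite mulrAC mulrA.
move=> i; apply: D2_sum => j; apply: D2_scale.
pose I k := `[Num.max a (k%:R / N%:R), Num.min b (k.+1%:R / N%:R)[%classic : set R.
(* Each of the two indicators splits into a half-open cell and the endpoint, and
   the product expands into four rectangles. *)
pose d k : R := (Num.truncn (N%:R * b) == k)%:R.
apply: (@D2_eq (fun x => \1_(I i) x.1 * \1_(I j) x.2 + d i * (\1_[set b] x.1 * \1_(I j) x.2)
   + d j * (\1_(I i) x.1 * \1_[set b] x.2) + d i * d j * (\1_[set b] x.1 * \1_[set b] x.2))).
  move=> [r s] [/=]; rewrite !in_itv/= => rab sab.
  by rewrite (floor_cells i N0 rab) (floor_cells j N0 sab) -/(d i) -/(d j) -/(I i) -/(I j); ring.
have cI k : cell a b (I k) by exact: cell_floor.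
have cb : cell a b [set b] by right.
by repeat first [apply: D2_add|apply: D2_scale]; apply: D2_rectangle.
Qed.

(** Products are enough, since the limit process is a finite sum of products of a
    function of [r] and a function of [s]. *)
Lemma D2_mul_continuous phi psi : {within `[a, b], continuous phi} ->
  {within `[a, b], continuous psi} -> D2 a b (fun x => phi x.1 * psi x.2).
Proof.
move=> cphi cpsi; apply: D2_uniform_limit => e e0.
have [L HL] := within_continuous_bounded cphi.
have [M HM] := within_continuous_bounded cpsi.
have L0 : 0 <= L by apply: le_trans (normr_ge0 _) (HL a _); rewrite lexx.
have M0 : 0 <= M by apply: le_trans (normr_ge0 _) (HM a _); rewrite lexx.
pose c := e / (L + M + 1).
have LM : 0 < L + M + 1 by rewrite ltr_wpDl// addr_ge0.
have c0 : 0 < c by rewrite divr_gt0.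
have [d1 d10 H1] := within_continuous_unif cphi c0.
have [d2 d20 H2] := within_continuous_unif cpsi c0.
have [N /(_ N (leqnn N)) [N0 HN]] : exists N, forall T, (N <= T)%N ->
    (0 < T)%N /\ T%:R^-1 <= Num.min d1 d2 / 2.
  by apply: inv_nat_le; rewrite divr_gt0// lt_min d10.
have N0' : 0 < N%:R :> R by rewrite ltr0n.
pose pt k := Num.max a (k%:R / N%:R) : R.
have ptP r : a <= r <= b -> a <= pt (Num.truncn (N%:R * r)) <= b /\
    `|r - pt (Num.truncn (N%:R * r))| < Num.min d1 d2.
  move=> /andP[ar rb]; have r0 : 0 <= r by apply: le_trans ar.
  have gd := grid_dist N0 r0.
  have mn : 0 < Num.min d1 d2 by rewrite lt_min d10.
  have /andP[h1 h2] := truncn_itv (mulr_ge0 (ltW N0') r0).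
  have kr : (Num.truncn (N%:R * r))%:R / N%:R <= r by rewrite ler_pdivrMr// [r * _]mulrC.
  rewrite /pt; split; first by rewrite le_max lexx/= ge_max (le_trans ar rb)/= (le_trans kr).
  have : Num.max a ((Num.truncn (N%:R * r))%:R / N%:R) <= r by rewrite ge_max ar.
  have : (Num.truncn (N%:R * r))%:R / N%:R <= Num.max a ((Num.truncn (N%:R * r))%:R / N%:R).
    by rewrite le_max lexx orbT.
  move=> h3 h4; rewrite ger0_norm ?subr_ge0//.
  by move: gd; rewrite ler_norml => /andP[h5 _]; lra.
exists (fun x => phi (pt (Num.truncn (N%:R * x.1))) * psi (pt (Num.truncn (N%:R * x.2)))).
  exact: (D2_floor (fun k l => phi (pt k) * psi (pt l)) N0).
move=> [r s] [/=]; rewrite !in_itv/= => rab sab.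
have [r'ab] := ptP r rab; have [s'ab] := ptP s sab; rewrite !lt_min => /andP[_ ds] /andP[dr _].
have p1 := ltW (H1 _ _ rab r'ab dr); have p2 := ltW (H2 _ _ sab s'ab ds).
set r' := pt _ in r'ab dr p1 *; set s' := pt _ in s'ab ds p2 *.
rewrite (_ : _ - _ = (phi r - phi r') * psi s' + phi r * (psi s - psi s')); last by ring.
rewrite (le_trans (ler_normD _ _))// !normrM.
have q1 : `|phi r - phi r'| * `|psi s'| <= c * M by apply: ler_pM => //; exact: HM.
have q2 : `|phi r| * `|psi s - psi s'| <= L * c by apply: ler_pM => //; exact: HL.
have : c * (L + M + 1) = e by rewrite divfK// gt_eqF.
nra.
Qed.

End plane_paths.

(** * The limit process *)

Section within_continuity.
Context {R : realType}.
Implicit Types (f g : R -> R).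

Lemma within_continuousM (a b : R) f g : {within `[a, b], continuous f} ->
  {within `[a, b], continuous g} -> {within `[a, b], continuous (fun u => f u * g u)}.
Proof. by move=> cf cg u; apply: cvgM; [exact: cf|exact: cg]. Qed.

Lemma within_continuousX (a b : R) f n : {within `[a, b], continuous f} ->
  {within `[a, b], continuous (fun u => f u ^+ n)}.
Proof.
move=> cf; elim: n => [|n IH].
  by apply: continuous_subspaceT => u; exact: cvg_cst.
rewrite (_ : (fun u => f u ^+ n.+1) = (fun u => f u * f u ^+ n)).
  exact: within_continuousM.
by apply/funext => u; rewrite exprS.
Qed.

Lemma within_continuousV (a b : R) : 0 < a -> {within `[a, b], continuous (fun u : R => u^-1)}.
Proof.
move=> a0; apply: continuous_subspace_itv => u; rewrite in_itv/= => /andP[au _].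
by apply: inv_continuous; rewrite gt_eqF// (lt_le_trans a0).
Qed.

Lemma within_lipschitz (a b M : R) f :
  (forall s t, a <= s -> s <= t -> t <= b -> `|f t - f s| <= M * (t - s)) ->
  {within `[a, b], continuous f}.
Proof.
move=> fM; apply/subspace_continuousP => s /=; rewrite in_itv/= => /andP[as_ sb].
apply/(@cvgrPdist_lt _ R^o) => e e0; rewrite near_withinE.
have M1 : 0 < `|M| + 1 by rewrite ltr_wpDl.
near=> t => /=; rewrite in_itv/= => /andP[at_ tb].
have : `|s - t| < e / (`|M| + 1).
  by near: t; exists (e / (`|M| + 1)) => //=; rewrite divr_gt0.
rewrite ltr_pdivlMr// => H; apply: le_lt_trans H.
have H0 : `|f s - f t| <= `|M| * `|s - t|.
  have [st|/ltW ts] := leP s t.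
    rewrite distrC [`|s - t|]distrC [`|t - s|]ger0_norm ?subr_ge0//.
    rewrite (le_trans (fM _ _ as_ st tb))// ler_wpM2r ?subr_ge0//; exact: ler_norm.
  rewrite [`|s - t|]ger0_norm ?subr_ge0//.
  rewrite (le_trans (fM _ _ at_ ts sb))// ler_wpM2r ?subr_ge0//; exact: ler_norm.
by rewrite (le_trans H0)// mulrDr mulr1 mulrC lerDl.
Unshelve. all: by end_near. Qed.

End within_continuity.

Section limit.
Context {R : realType}.
Variables (p : nat) (kappa eta : R).
Hypothesis kappa_gt0 : 0 < kappa.
Hypothesis kappa_lt1 : kappa < 1.
Hypothesis eta_gt0 : 0 < eta.
Implicit Types (f g : R -> R).

Lemma primitiveZ f (c s : R) : {within `[0, 1], continuous f} -> s <= 1 ->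
  primitive (fun u => c * f u) s = c * primitive f s.
Proof.
move=> cf s1; rewrite /primitive RintegralZl//.
apply: continuous_compact_integrable; first exact: segment_compact.
exact: within_sub cf.
Qed.

Lemma momentZ f (c s : R) b : {within `[0, 1], continuous f} -> s <= 1 ->
  moment (fun u => c * f u) b s = c * moment f b s.
Proof.
move=> cf s1; rewrite /moment -primitiveZ//; last exact: continuous_moment_integrand.
by congr primitive; apply/funext => u; rewrite mulrCA.
Qed.

Lemma mul_row_mx_col (m n : nat) (v : 'cV[R]_m) (A : 'M[R]_(m, n)) (y : 'cV[R]_n) :
  (v^T *m A *m y) 0 0 = \sum_(a < m) \sum_(b < n) v^T 0 a * A a b * y b 0.
Proof.
rewrite mxE exchange_big/=; apply: eq_bigr => b _.
by rewrite mxE mulr_suml.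
Qed.

(** Powers of [s^-1] are taken out of the integrals, and [eta] is moved into the
    path. *)
Lemma limit_processE f x : {within `[0, 1], continuous f} -> square kappa 1 x ->
  limit_process p kappa eta f x =
  if x.1 <= x.2 then projection_residual p (fun u => eta * f u) x else 0.
Proof.
case: x => r s cf [/=]; rewrite !in_itv/= => /andP[kr r1] /andP[ks s1].
rewrite kr /=; case: ifP => // rs.
have s0 : 0 < s by apply: lt_le_trans ks.
rewrite /projection_residual/= mulrBr; congr (_ - _).
rewrite mul_row_mx_col mulr_sumr; apply: eq_bigr => a _.
rewrite mulr_sumr; apply: eq_bigr => b _.
rewrite [(vvec _ _ _)^T 0 a]mxE [vvec _ _ _ a 0]mxE.
rewrite [X in _ * (_ * X * _) = _]mxE [X in _ * (_ * _ * X) = _]mxE momentZ//.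
rewrite (_ : \int[lebesgue_measure]_(u in `[0, s]) (vvec p u s b 0 * f u) =
   s^-1 ^+ b * moment f b s); first by rewrite exprS; ring.
rewrite /moment -primitiveZ//; last exact: continuous_moment_integrand.
by apply: eq_Rintegral => u _; rewrite mxE exprMn -mulrA mulrCA.
Qed.

Lemma continuous_moment f b : {within `[0, 1], continuous f} ->
  {within `[0, 1], continuous (moment f b)}.
Proof.
move=> cf; have cm := continuous_moment_integrand (b := b) cf.
have [M HM] := within_continuous_bounded cm.
by apply: (@within_lipschitz _ _ _ M) => s t; exact: primitive_lipschitz.
Qed.

Lemma D2_projection_residual f : {within `[0, 1], continuous f} ->
  D2 kappa 1 (projection_residual p f).
Proof.
move=> cf; have k0 := ltW kappa_gt0; have k1 := ltW kappa_lt1.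
have ccst (c : R) : {within `[kappa, 1], continuous (fun=> c)}.
  by apply: continuous_subspaceT => u; exact: cvg_cst.
have cfk : {within `[kappa, 1], continuous f} by apply: within_sub cf.
pose phi (a : nat) (r : R) := r ^+ a.
pose psi (a b : 'I_p.+1) (s : R) :=
  s^-1 ^+ a * invmx (@hilbert_matrix R p) a b * (s^-1 ^+ b.+1 * moment f b s).
apply: (@D2_eq _ _ _ (fun x => f x.1 * 1 + (-1) *
    \sum_(a < p.+1) \sum_(b < p.+1) phi a x.1 * psi a b x.2)).
  move=> x _; rewrite mulr1 mulN1r; congr (_ - _).
  by apply: eq_bigr => a _; apply: eq_bigr => b _; rewrite /phi /psi exprMn !mulrA.
apply: D2_add; first exact: (D2_mul_continuous k0 k1 cfk (ccst 1)).
apply: D2_scale; apply: D2_sum => a; apply: D2_sum => b.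
apply: (D2_mul_continuous k0 k1).
  by apply: continuous_subspaceT => u; exact: exprn_continuous.
apply: within_continuousM.
  apply: within_continuousM => //.
  by apply: within_continuousX; exact: within_continuousV.
apply: within_continuousM.
  by apply: within_continuousX; exact: within_continuousV.
have cm : {within `[0, 1], continuous (moment f b)} by exact: continuous_moment.
by apply: within_sub cm.
Qed.

Lemma D2_diag_limit_process f : {within `[0, 1], continuous f} ->
  D2_diag kappa 1 (limit_process p kappa eta f).
Proof.
move=> cf; exists (projection_residual p (fun u => eta * f u)), (fun=> 0); split.
- apply: D2_projection_residual; apply: within_continuousM => //.
  by apply: continuous_subspaceT => u; exact: cvg_cst.
- exact: D2_0.
- by move=> x sx; rewrite limit_processE.
Qed.

(** Integrals of continuous paths are limits of Riemann sums, which involve finitely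
    many coordinates each. *)
Lemma measurable_moment d (Omega : measurableType d) (W : Omega -> R -> R) b s :
  (forall w, {within `[0, 1], continuous (W w)}) ->
  (forall u, 0 <= u <= 1 -> measurable_fun setT (fun w => W w u)) ->
  0 <= s <= 1 -> measurable_fun setT (fun w => moment (W w) b s).
Proof.
move=> cW mW s01.
pose h (T : nat) w := T%:R^-1 * \sum_(i < Num.truncn (T%:R * s))
  ((i.+1%:R / T%:R) ^+ b * W w (i.+1%:R / T%:R)) : R.
apply: (@measurable_fun_cvg _ _ _ _ h).
  move=> T; apply: measurable_funM => //; apply: measurable_sum => i.
  apply: measurable_funM => //; apply: mW; apply: grid_in01.
  by apply: leq_trans (ltn_ord i) _; apply: grid_le1; case/andP: s01.
move=> w _; apply/(@cvgrPdist_le _ R^o) => e e0.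
have [N HN] := riemann_sum (continuous_moment_integrand (b := b) (cW w)) e0.
by exists N => // T /= NT; rewrite distrC; exact: HN.
Qed.

Lemma measurable_limit_process d (Omega : measurableType d) (W : Omega -> R -> R) x :
  (forall w, {within `[0, 1], continuous (W w)}) ->
  (forall u, 0 <= u <= 1 -> measurable_fun setT (fun w => W w u)) ->
  square kappa 1 x -> measurable_fun setT (fun w => limit_process p kappa eta (W w) x).
Proof.
move=> cW mW sx.
rewrite (_ : (fun w => _) = fun w => if x.1 <= x.2 then
    projection_residual p (fun u => eta * W w u) x else 0); last first.
  by apply/funext => w; rewrite limit_processE.
case: (x.1 <= x.2); last exact: measurable_cst.
have sx' := sx; case: sx' => /=; rewrite !in_itv/= => /andP[kr r1] /andP[ks s1].
have k0 := ltW kappa_gt0.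
apply: measurable_funB.
  by apply: measurable_funM => //; apply: mW; rewrite r1 (le_trans k0).
apply: measurable_sum => a; apply: measurable_sum => b.
apply: measurable_funM => //; apply: measurable_funM => //.
apply: measurable_moment.
- move=> w; apply: within_continuousM => //.
  by apply: continuous_subspaceT => u; exact: cvg_cst.
- by move=> u u01; apply: measurable_funM => //; exact: mW.
- by rewrite s1 (le_trans k0).
Qed.

End limit.

(** * The residual process *)

Section skorohod_distance.
Context {R : realType}.

Lemma d2_le (a b : R) f g (c : R) : 0 < c ->
  (forall x, square a b x -> `|f x - g x| <= c) -> d2 a b f g <= c.
Proof.
move=> c0 fg; apply: ge_inf; first by exists 0 => e [/ltW].
split => //; exists id, id; split; [exact: time_change_id..| |].
  by move=> x _; rewrite subrr normr0 ltW.
by move=> -[r s] /=; exact: fg.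
Qed.

End skorohod_distance.

Section residual_process.
Context {R : realType}.
Variables (p : nat) (kappa : R).
Hypothesis kappa_gt0 : 0 < kappa.
Hypothesis kappa_lt1 : kappa < 1.

Lemma D2_diag_residual_process (Y : nat -> R) T :
  D2_diag kappa 1 (residual_process p kappa Y T).
Proof.
have k0 := ltW kappa_gt0; have k1 := ltW kappa_lt1.
pose g (x : R * R) := (Num.sqrt T%:R)^-1 *
  residual p Y (Num.truncn (T%:R * x.1)) (Num.truncn (T%:R * x.2)).
exists g, (fun=> 0); split; [|exact: D2_0|].
  have [T0|T0] := posnP T.
    by apply: D2_eq (D2_0 _ _) => x _; rewrite /g T0 sqrtr0 invr0 mul0r.
  have := D2_floor 1 k0 (fun k t => (Num.sqrt T%:R)^-1 * residual p Y k t) T0.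
  by apply: D2_eq.
move=> [r s] [/=]; rewrite !in_itv/= => /andP[kr _] _.
by rewrite /residual_process/= kr.
Qed.

Context d (Omega : measurableType d) (P : probability Omega R).

Lemma measurable_residual_process (Y : nat -> {RV P >-> R}) T x :
  measurable_fun setT (fun w => residual_process p kappa (fun t => Y t w) T x).
Proof.
case: x => r s; rewrite /residual_process.
case: (kappa <= r <= s); last exact: measurable_cst.
apply: measurable_funM => //.
rewrite /residual; apply: measurable_funB => //.
set k := Num.truncn (T%:R * r); set t := Num.truncn (T%:R * s).
rewrite (_ : (fun w => _) = (fun w => \sum_(i < t)
  ((regressor p k)^T *m invmx ((design p t)^T *m design p t) *m
     (design p t)^T) 0 i * Y i.+1 w)).
  by apply: measurable_sum => i; apply: measurable_funM.
by apply/funext => w; rewrite mxE; apply: eq_bigr => i _; rewrite [in X in _ * X]mxE.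
Qed.

Lemma random_walk (eps u : nat -> Omega -> R) w :
  (forall t, (0 < t)%N -> eps t w = eps t.-1 w + u t w) ->
  forall k, eps k w = eps 0%N w + \sum_(1 <= i < k.+1) u i w.
Proof.
move=> H; elim => [|k IH]; first by rewrite big_geq// addr0.
by rewrite H// IH [in RHS]big_nat_recr//= addrA.
Qed.

(** Once [T * kappa] is large, all Gram matrices met on the triangle are invertible.
    Then the trend and the initial value of the random walk, which is a constant
    trend, drop out, and the remaining partial sums are the values of the
    partial sum process at the points [i / T]. *)
Lemma residual_process_sampled : exists N, forall T, (N <= T)%N ->
  forall (beta : 'I_p.+1 -> R) (Y eps u : nat -> {RV P >-> R}),
  (forall t w, (0 < t)%N -> Y t w = \sum_(j < p.+1) beta j * t%:R ^+ j + eps t w) ->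
  (forall t w, (0 < t)%N -> eps t w = eps t.-1 w + u t w) ->
  forall w x, kappa <= x.1 -> x.1 <= x.2 -> x.2 <= 1 ->
  residual_process p kappa (fun t => Y t w) T x =
  sampled_residual p T (partial_sum_process u T w) x.
Proof.
have [[N _ HN] _] := @cvg_scaled_gram R p.
(* Every grid index met on the triangle is at least [T * kappa], rounded down. *)
exists (Num.truncn ((maxn 1 N)%:R / kappa)).+1 => T NT beta Y eps u hY hwalk w [r s] /= kr rs s1.
have T0 : (0 < T)%N by apply: leq_trans NT.
have T0' : 0 < T%:R :> R by rewrite ltr0n.
have big v : kappa <= v -> (maxn 1 N <= Num.truncn (T%:R * v))%N.
  move=> kv; rewrite truncn_ge_nat; last by rewrite mulr_ge0// (le_trans (ltW kappa_gt0)).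
  apply: (@le_trans _ _ (T%:R * kappa)); last by rewrite ler_wpM2l.
  rewrite -ler_pdivrMr//; apply/ltW/(lt_le_trans (truncnS_gt _)).
  by rewrite ler_nat.
rewrite kr rs /=.
have := big r kr; rewrite geq_max => /andP[k0 _].
have := big s (le_trans kr rs); rewrite geq_max => /andP[t0 /HN/= uG].
set k := Num.truncn (T%:R * r) in k0 *; set t := Num.truncn (T%:R * s) in t0 uG *.
pose Z i := \sum_(1 <= l < i.+1) u l w.
pose b (j : 'I_p.+1) := beta j + (j == 0)%:R * eps 0%N w.
rewrite (@residual_trend _ _ b _ Z k t)//; last first.
  move=> i i0; rewrite hY// (random_walk (eps := fun l => eps l : Omega -> R)
    (u := fun l => u l : Omega -> R) (fun l => hwalk l w)) addrA; congr (_ + _).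
  rewrite /b [RHS](eq_bigr (fun j : 'I_p.+1 =>
    beta j * i%:R ^+ j + ((j == 0)%:R * eps 0%N w) * i%:R ^+ j)); last first.
    by move=> j _; rewrite mulrDl.
  rewrite big_split/=; congr (_ + _).
  rewrite (bigD1 ord0)//= expr0 mulr1 mul1r big1 ?addr0// => j j0.
  by rewrite (negbTE j0) !mul0r.
have ZE i : partial_sum_process u T w (i%:R / T%:R) = (Num.sqrt T%:R)^-1 * Z i.
  by rewrite /partial_sum_process [T%:R * (_ / _)]mulrC divfK ?gt_eqF// natrK.
rewrite residual_scaled// /sampled_residual/= -/k -/t ZE mulrBr; congr (_ - _).
rewrite mulr_sumr; apply: eq_bigr => a _; rewrite mulr_sumr; apply: eq_bigr => c _.
rewrite mulrCA; congr (_ * _); rewrite mulrCA; congr (_ * _).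
by rewrite mulr_sumr; apply: eq_bigr => i _; rewrite ZE mulrCA.
Qed.

End residual_process.

Theorem theorem3p2 (R : realType) (p : nat) (kappa : R)
  (hkappa : 0 < kappa < 1)
  (d : measure_display) (Omega : measurableType d) (P : probability Omega R)
  (d' : measure_display) (Omega' : measurableType d')
  (P' : probability Omega' R)
  (beta : 'I_p.+1 -> R) (Y eps u : nat -> {RV P >-> R})
  (eta : R) (B : R -> {RV P' >-> R})
  (hY : forall t w, (0 < t)%N ->
     Y t w = \sum_(j < p.+1) beta j * t%:R ^+ j + eps t w)
  (heps : forall t, (0 < t)%N -> ('E_P[eps t] = 0)%E)
  (hwalk : forall t w, (0 < t)%N -> eps t w = eps t.-1 w + u t w)
  (heta : 0 < eta)
  (hB : brownian_motion B)
  (hu : assumption_E u eta B) :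
  weak_cvg (square kappa 1) (D2_diag kappa 1) (d2 kappa 1) P P'
    (fun T w => residual_process p kappa (fun t => Y t w) T)
    (fun w => limit_process p kappa eta (fun t => B t w)).
Proof.
case/andP: hkappa => kappa0 kappa1.
have [_ _ _ SW] := hu; have [_ _ _ cB] := hB.
have ccst (c : R) : {within `[0, 1], continuous (fun _ : R => c)}.
  by apply: continuous_subspaceT => v; exact: cvg_cst.
have cZ (c : R) (f : R -> R) : {within `[0, 1], continuous f} ->
  {within `[0, 1], continuous (fun v => c * f v)}.
  by move=> cf; exact: within_continuousM.
(* The factor [eta^-1] makes [Phi (eta * B)] the limit process as a function on the
   whole plane, although [B] is only controlled on [[0, 1]]. *)
pose Phi (f : R -> R) := limit_process p kappa eta (fun v => eta^-1 * f v).
have PhiE (f : R -> R) x : {within `[0, 1], continuous f} -> square kappa 1 x ->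
    Phi f x = if x.1 <= x.2 then projection_residual p f x else 0.
  move=> cf sx; rewrite /Phi limit_processE//; last exact: cZ.
  congr (if _ then projection_residual p _ _ else _); apply/funext => v.
  by rewrite mulrA divff ?gt_eqF// mul1r.
have tri x : square kappa 1 x -> x.1 <= x.2 -> kappa <= x.1 /\ x.1 <= x.2 /\ x.2 <= 1.
  by case: x => r s [/=]; rewrite !in_itv/= => /andP[-> _] /andP[_ ->].
have PhiB w : Phi (fun v => eta * B v w) = limit_process p kappa eta (fun v => B v w).
  congr limit_process; apply/funext => v.
  by rewrite mulrA mulVf ?gt_eqF// mul1r.
rewrite (_ : (fun w => limit_process p kappa eta (fun v => B v w)) =
  (fun w => Phi (fun v => eta * B v w))); last by apply/funext => w; rewrite PhiB.
have C0 : 0 <= @residual_bound R p by exact: residual_bound_ge0.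
have cW w : {within `[0, 1], continuous (fun v => eta * B v w)} by exact: cZ.
apply: (weak_cvg_transfer (Phi := Phi) _ SW cW C0).
- by move=> f g c; exact: d2_le.
- by move=> g cg; apply: D2_diag_limit_process => //; exact: cZ.
- move=> f g c cf cg fg x sx; rewrite !PhiE//; case: ifPn => [x12|_].
    exact: (@projection_residual_lipschitz R p kappa kappa0 f g c cf cg fg x (tri x sx x12)).
  rewrite subrr normr0 mulr_ge0//.
  by apply: le_trans (normr_ge0 _) (fg 0 _); rewrite lexx ler01.
- move=> T; apply: random_element_coordinates => [w|x _].
    exact: D2_diag_residual_process.
  exact: measurable_residual_process.
- apply: random_element_coordinates => [w|x sx].
    by rewrite PhiB; exact: D2_diag_limit_process.
  under eq_fun do rewrite PhiB.
  exact: measurable_limit_process.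
move=> g cg e e0.
have [N1 H1] := sampled_residual_approx p kappa0 cg e0.
have [N2 H2] := residual_process_sampled p kappa0 P.
exists (maxn N1 N2) => T; rewrite geq_max => /andP[T1 T2] w x sx.
have [rS _ _] := SW; have DS : D1 0 1 (partial_sum_process u T w) by case: (rS T).
rewrite PhiE//; case: ifPn => x12.
  have [k1 [_ x2]] := tri x sx x12.
  by rewrite (H2 T T2 beta Y eps u)//; apply: H1.
rewrite /residual_process; case: x sx x12 => r s /= _ /negbTE ->; rewrite andbF subrr normr0.
by rewrite addr_ge0 ?(ltW e0)// mulr_ge0// supdist_ge0.
Qed.
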